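(* Let $X$ be a compact Riemann surface of genus $g\geq 2$ and let $(W,\Omega,\varphi)$ be a polystable $\mathrm{U}^*(2n)$-Higgs bundle over $X$. There is a decomposition of $(W,\Omega,\varphi)$ as a sum of stable $G_i$-Higgs bundles, where each $G_i$ is one of the following subgroups of $\mathrm{U}^*(2n)$: $\mathrm{U}^*(2n_i)$, $\mathrm{GL}(n_i,\mathbb{C})$, $\mathrm{Sp}(2n_i)$ or $\mathrm{U}(n_i)$ (with $n_i\leq n$).
   Context: Let $K$ be the canonical line bundle of $X$. A $\mathrm{U}^*(2n)$-Higgs bundle over $X$ is a triple $(W,\Omega,\varphi)$, where $W$ is a holomorphic vector bundle of rank $2n$, $\Omega\in H^0(X,\Lambda^2W^* )$ is a symplectic form on $W$, and $\varphi\in H^0(X,S^2_\Omega W\otimes K)$, where $S^2_\Omega W\subset \mathrm{End}(W)$ is the bundle of endomorphisms $\xi$ with $\Omega(\xi\cdot,\cdot)=\Omega(\cdot,\xi\cdot)$. A holomorphic subbundle $W'\subset W$ is $\varphi$-invariant if $\varphi(W')\subset W'\otimes K$; it is isotropic if $W'\subset W'^{\perp_\Omega}$ and coisotropic if $W'^{\perp_\Omega}\subset W'$. $(W,\Omega,\varphi)$ is semistable if $\deg W'\leq 0$ for every isotropic $\varphi$-invariant subbundle $W'$; stable if moreover $\deg W'<0$ for every isotropic $\varphi$-invariant strict subbundle $W'\neq 0$; polystable if it is semistable and, for every isotropic (resp. coisotropic) $\varphi$-invariant strict subbundle $0\neq W'\subsetneq W$ with $\deg W'=0$, there is a coisotropic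 (resp. isotropic) $\varphi$-invariant subbundle $0\neq W''\subset W$ with $W=W'\oplus W''$. Other groups. A $\mathrm{GL}(m,\mathbb{C})$-Higgs bundle is a pair $(V,\phi)$ with $V$ a holomorphic bundle of rank $m$ and $\phi\in H^0(\mathrm{End}(V)\otimes K)$; it is stable if $\deg(V')/\mathrm{rk}(V')<\deg(V)/\mathrm{rk}(V)$ for every proper nonzero $\phi$-invariant subbundle $V'$. A (stable) $\mathrm{U}(m)$-Higgs bundle is a (stable) holomorphic vector bundle of rank $m$, i.e. the case $\phi=0$. A (stable) $\mathrm{Sp}(2m)$-Higgs bundle is a (stable) holomorphic symplectic vector bundle $(W,\Omega)$ of rank $2m$, i.e. a (stable) $\mathrm{U}^*(2m)$-Higgs bundle with zero Higgs field. The group $\mathrm{GL}(m,\mathbb{C})$ is regarded as a subgroup of $\mathrm{U}^*(2m)$ via $A\mapsto \begin{pmatrix}A&0\\0&\overline{A}\end{pmatrix}$, restricting on $\mathrm{U}(m)$ to $A\mapsto\begin{pmatrix}A&0\\0&(A^t)^{-1}\end{pmatrix}$. Correspondingly, a $\mathrm{GL}(m,\mathbb{C})$-Higgs bundle $(V,\phi)$ is regarded as the $\mathrm{U}^*(2m)$-Higgs bundle $(V\oplus V^*,\Omega_{\mathrm{st}},\phi\oplus\phi^t)$, with $\Omega_{\mathrm{st}}$ the standard symplectic form given by the duality pairing of $V$ and $V^*$; likewise for $\mathrm{U}(m)$ with $\phi=0$. ''A decomposition of $(W,\Omega,\varphi)$ as a sum of stable $G_i$-Higgs bundles'' means an isomorphism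 of $(W,\Omega,\varphi)$ with a direct sum $\bigoplus_i (W_i,\Omega_i,\varphi_i)$ (with $\Omega=\bigoplus\Omega_i$, $\varphi=\bigoplus\varphi_i$), where each $(W_i,\Omega_i,\varphi_i)$ is the $\mathrm{U}^*(2n_i)$-Higgs bundle obtained, as just described, from a stable $G_i$-Higgs bundle. *)

(* Defs.v *)
From HB Require Import structures.
From mathcomp Require Import all_boot all_order all_algebra.
From mathcomp Require Import complex.
From mathcomp Require Import mathcomp_extra boolp classical_sets functions.
From mathcomp Require Import cardinality fsbigop reals topology normedtype.
From mathcomp Require Import derive.

Set Implicit Arguments.
Unset Strict Implicit.
Unset Printing Implicit Defensive.

Import Order.TTheory GRing.Theory Num.Theory.
Import numFieldNormedType.Exports.
Local Open Scope classical_set_scope.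
Local Open Scope ring_scope.

(* The detour through numClosedFieldType gives R[i] the topology and the
   normed-space structure that MathComp-Analysis puts on a numFieldType, so that
   [derivable f z 1] below is complex differentiability. The lock keeps
   unification from unfolding R[i] into pairs of reals, which does not end. *)
HB.lock Definition cplx (R : realType) : numClosedFieldType := complex R.

(* chart_inv i is only meaningful on the image of cdom i under chart i. *)
Record riemann_surface (R : realType) := RiemannSurface {
  rs_space :> topologicalType;
  cidx : Type;
  cdom : cidx -> set rs_space;
  chart : cidx -> rs_space -> cplx R;
  chart_inv : cidx -> cplx R -> rs_space;
  rs_nonempty : [set: rs_space] !=set0;
  rs_hausdorff : hausdorff_space rs_space;
  rs_connected : connected [set: rs_space];
  cdom_open : forall i, open (cdom i);
  cdom_cover : forall x, exists i, cdom i x;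
  chart_open : forall i, open (chart i @` cdom i);
  chartK : forall i x, cdom i x -> chart_inv i (chart i x) = x;
  chart_continuous : forall i x, cdom i x -> {for x, continuous (chart i)};
  chart_inv_continuous : forall i x, cdom i x ->
    {for chart i x, continuous (chart_inv i)};
  chart_holo : forall i j x, cdom i x -> cdom j x ->
    derivable (chart j \o chart_inv i) (chart i x) 1 }.

Section Holomorphic.
Variables (R : realType) (X : riemann_surface R).
Let C := cplx R.

Definition holo_at (x : X) (f : X -> C) := forall i, cdom i x ->
  derivable (f \o @chart_inv R X i) (chart i x) 1.

Definition holo_on (U : set X) (f : X -> C) := forall x, U x -> holo_at x f.

(* d z_j / d z_i at x, where z_i, z_j are the charts i and j *)
Definition dchart (i j : cidx X) (x : X) : C :=
  derive1 (@chart R X j \o @chart_inv R X i) (chart i x).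

(* A section of the canonical bundle K is a family (w_i) indexed by the charts,
   standing for w_i dz_i, with w_i dz_i = w_j dz_j on overlaps; the values of
   w_i outside of cdom i are irrelevant. *)
Definition holo_form (w : cidx X -> X -> C) :=
  (forall i, holo_on (cdom i) (w i)) /\
  (forall i j x, cdom i x -> cdom j x -> w i x = dchart i j x * w j x).

(* dim H^0(X, K) = g *)
Definition has_genus (g : nat) := exists w : 'I_g -> cidx X -> X -> C,
  [/\ forall k, holo_form (w k),
      forall c : 'I_g -> C,
        (forall i x, cdom i x -> \sum_k c k * w k i x = 0) ->
        forall k, c k = 0
    & forall v, holo_form v -> exists c : 'I_g -> C,
        forall i x, cdom i x -> v i x = \sum_k c k * w k i x].

Lemma holo_at_cst x c : holo_at x (fun=> c).
Proof. by move=> i _; exact: derivable_cst. Qed.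

Lemma holo_atD x f g : holo_at x f -> holo_at x g ->
  holo_at x (fun y => f y + g y).
Proof. by move=> hf hg i ix; exact: (derivableD (hf i ix) (hg i ix)). Qed.

Lemma holo_atM x f g : holo_at x f -> holo_at x g ->
  holo_at x (fun y => f y * g y).
Proof. by move=> hf hg i ix; exact: (derivableM (hf i ix) (hg i ix)). Qed.

Lemma holo_atN x f : holo_at x f -> holo_at x (fun y => - f y).
Proof. by move=> hf i ix; exact: (derivableN (hf i ix)). Qed.

Lemma holo_atV x f : f x != 0 -> holo_at x f -> holo_at x (fun y => (f y)^-1).
Proof.
move=> fx hf i ix; apply: derivableV (hf i ix).
by rewrite /= chartK.
Qed.

Lemma holo_at_sum x I (r : seq I) (P : pred I) (F : I -> X -> C) :
  (forall k, P k -> holo_at x (F k)) ->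
  holo_at x (fun y => \sum_(k <- r | P k) F k y).
Proof.
move=> hF; elim: r => [|k r IH].
  by rewrite (_ : (fun _ => _) = fun=> 0); [exact: holo_at_cst|
    apply/funext => y; rewrite big_nil].
case Pk: (P k).
  rewrite (_ : (fun _ => _) = fun y => F k y + \sum_(k <- r | P k) F k y).
    by apply: holo_atD; [exact: hF | exact: IH].
  by apply/funext => y; rewrite big_cons Pk.
by rewrite (_ : (fun _ => _) = fun y => \sum_(k <- r | P k) F k y) //;
  apply/funext => y; rewrite big_cons Pk.
Qed.

Lemma holo_at_prod x I (r : seq I) (P : pred I) (F : I -> X -> C) :
  (forall k, P k -> holo_at x (F k)) ->
  holo_at x (fun y => \prod_(k <- r | P k) F k y).
Proof.
move=> hF; elim: r => [|k r IH].
  by rewrite (_ : (fun _ => _) = fun=> 1); [exact: holo_at_cst|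
    apply/funext => y; rewrite big_nil].
case Pk: (P k).
  rewrite (_ : (fun _ => _) = fun y => F k y * \prod_(k <- r | P k) F k y).
    by apply: holo_atM; [exact: hF | exact: IH].
  by apply/funext => y; rewrite big_cons Pk.
by rewrite (_ : (fun _ => _) = fun y => \prod_(k <- r | P k) F k y) //;
  apply/funext => y; rewrite big_cons Pk.
Qed.

Lemma holo_at_det x n (A : X -> 'M[C]_n) :
  (forall k l, holo_at x (fun y => A y k l)) ->
  holo_at x (fun y => \det (A y)).
Proof.
move=> hA; rewrite /determinant; apply: holo_at_sum => s _.
by apply: holo_atM; [exact: holo_at_cst | exact: holo_at_prod].
Qed.

Lemma holo_at_mulmx x m n p (A : X -> 'M[C]_(m, n)) (B : X -> 'M[C]_(n, p)) :
  (forall k l, holo_at x (fun y => A y k l)) ->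
  (forall k l, holo_at x (fun y => B y k l)) ->
  forall k l, holo_at x (fun y => (A y *m B y) k l).
Proof.
move=> hA hB k l.
rewrite (_ : (fun _ => _) = fun y => \sum_j A y k j * B y j l).
  by apply: holo_at_sum => j _; exact: holo_atM.
by apply/funext => y; rewrite mxE.
Qed.

Lemma holo_at_adj x n (A : X -> 'M[C]_n) :
  (forall k l, holo_at x (fun y => A y k l)) ->
  forall k l, holo_at x (fun y => (\adj (A y)) k l).
Proof.
move=> hA k l; rewrite (_ : (fun _ => _) = fun y => cofactor (A y) l k).
  apply: holo_atM; first exact: holo_at_cst.
  apply: holo_at_det => a b.
  by rewrite (_ : (fun _ => _) = fun y => A y (lift l a) (lift k b)) //;
    apply/funext => y; rewrite !mxE.
by apply/funext => y; rewrite mxE.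
Qed.

Lemma nbhs_chart x i (U : set X) : cdom i x -> open U -> U x ->
  \forall z \near (chart i x : C), U (chart_inv i z).
Proof.
move=> ix oU Ux.
apply: (chart_inv_continuous ix); rewrite /= chartK //.
exact: open_nbhs_nbhs.
Qed.

(* f may be altered away from a neighbourhood of x and from the zeros of d. *)
Lemma holo_at_near x (f g d : X -> C) (U : set X) : open U -> U x ->
  holo_at x d -> d x != 0 ->
  (forall y, U y -> d y != 0 -> f y = g y) -> holo_at x g -> holo_at x f.
Proof.
move=> oU Ux hd dx0 fg hg i ix.
apply: near_eq_derivable (hg i ix).
have dc : {for chart i x, continuous (d \o @chart_inv R X i)}.
  by apply: differentiable_continuous; apply/derivable1_diffP; exact: hd.
have dn : \forall z \near (chart i x : C), d (chart_inv i z) != 0.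
  by apply: (cvgr_neq0 _ dc); rewrite /= chartK.
near=> z; rewrite /=; apply/esym/fg.
  by near: z; exact: nbhs_chart.
by near: z.
Unshelve. all: by end_near. Qed.

End Holomorphic.

(* A bundle is a family of vector spaces with an atlas of local frames whose
   transition matrices are holomorphic. *)
Record bundle (R : realType) (X : riemann_surface R) := Bundle {
  fib : X -> vectType (cplx R);
  rk : nat;
  fidx : Type;
  fdom : fidx -> set X;
  frame : fidx -> forall x, rk.-tuple (fib x);
  fdom_open : forall a, open (fdom a);
  fdom_cover : forall x, exists a, fdom a x;
  frame_basis : forall a x, fdom a x -> basis_of fullv (frame a x);
  frame_holo : forall a b k l, holo_on (fdom a `&` fdom b)
    (fun x => coord (frame a x) k (tnth (frame b x) l)) }.

Section Bundles.
Variables (R : realType) (X : riemann_surface R).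
Let C := cplx R.

Definition holo_section (E : bundle X) (U : set X) (s : forall x, fib E x) :=
  forall a k, holo_on (U `&` fdom a) (fun x => coord (frame a x) k (s x)).

Definition frame_change (E : bundle X) (a b : fidx E) (x : X) : 'M[C]_(rk E) :=
  \matrix_(k, l) coord (frame a x) k (tnth (frame b x) l).

(* s represents, in the trivializations of det E given by the local frames of E,
   a meromorphic section of det E that does not vanish identically, and ord p is
   its order at p. *)
Definition det_mero_section (E : bundle X) (s : fidx E -> X -> C)
    (ord : X -> int) :=
  (forall a b x, fdom a x -> fdom b x -> s a x = \det (frame_change a b x) * s b x) /\
  (forall a i p, fdom a p -> cdom i p -> exists (V : set X) (u : X -> C),
    [/\ open V, V p, holo_on V u, forall x, V x -> u x != 0
      & forall x, V x -> fdom a x -> cdom i x -> x <> p ->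
          s a x = (chart i x - chart i p) ^ ord p * u x]).

Definition has_degree (E : bundle X) (d : int) := exists s ord,
  [/\ @det_mero_section E s ord, finite_set [set p | ord p != 0]
    & d = \sum_(p \in [set: X]) ord p].

(* On a compact X every line bundle has a nonzero meromorphic section, and the
   degree of its divisor only depends on the bundle: the default 0 is not used. *)
Definition deg (E : bundle X) : int := xget 0 [set d | has_degree E d].

Lemma basis_coordP (V : vectType C) n (e : n.-tuple V) (c : 'I_n -> V -> C) :
  (forall k, scalar (c k)) -> (forall v, v = \sum_k c k v *: tnth e k) ->
  (forall k l, c k (tnth e l) = (k == l)%:R) ->
  basis_of fullv e /\ forall k v, coord e k v = c k v.
Proof.
move=> clin cspan cdelta.
have c0 k : c k 0 = 0.
  have := clin k 1 0 0; rewrite scaler0 addr0 mul1r => c00.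
  by apply/(addrI (c k 0)); rewrite -c00 addr0.
have cD k : {morph c k : u v / u + v}.
  by move=> u v; have := clin k 1 u v; rewrite scale1r mul1r.
have csum k (f : 'I_n -> C) : c k (\sum_l f l *: tnth e l) = f k.
  rewrite (big_morph (c k) (cD k) (c0 k)) (bigD1 k) //= big1 => [|l lk].
    by rewrite addr0 -[_ *: _]addr0 clin cdelta c0 eqxx mulr1 addr0.
  by rewrite -[_ *: _]addr0 clin cdelta c0 eq_sym (negbTE lk) mulr0 addr0.
have efree : free e.
  apply/freeP => f f0 k; rewrite -(csum k f).
  rewrite (_ : \sum_l _ = 0) // -[RHS]f0.
  by apply: eq_bigr => l _; rewrite (tnth_nth 0).
have cE k v : coord e k v = c k v.
  rewrite {1}[v]cspan (eq_bigr (fun l => c l v *: e`_l)) => [|l _].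
    by rewrite coord_sum_free.
  by rewrite (tnth_nth 0).
split=> //; rewrite basisEfree efree subvf /=.
move: efree; rewrite /free => /eqP <-.
apply: dimvS; apply/subvP => v _; rewrite [v]cspan.
by apply: memv_suml => l _; rewrite memvZ // memv_span // mem_tnth.
Qed.

Lemma frame_span (E : bundle X) a x v : fdom a x ->
  v = \sum_k coord (frame a x) k v *: tnth (@frame R X E a x) k.
Proof.
move=> ax; rewrite {1}(coord_basis (frame_basis ax) (memvf v)).
by apply: eq_bigr => k _; rewrite (tnth_nth 0).
Qed.

Lemma frame_delta (E : bundle X) a x k l : fdom a x ->
  coord (frame a x) k (tnth (@frame R X E a x) l) = (k == l)%:R.
Proof.
move=> ax; rewrite (tnth_nth 0) coord_free // 1?eq_sym //.
exact: basis_free (frame_basis ax).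
Qed.

Section Dsum.
Variables E F : bundle X.

Definition dsum_frame (a : fidx E * fidx F) x :
    (rk E + rk F).-tuple (fib E x * fib F x)%type :=
  cat_tuple (map_tuple (fun u => (u, 0)) (frame a.1 x))
            (map_tuple (fun v => (0, v)) (frame a.2 x)).

Definition dsum_coord (a : fidx E * fidx F) x (k : 'I_(rk E + rk F))
    (w : (fib E x * fib F x)%type) : C :=
  match fintype.split k with
  | inl k => coord (frame a.1 x) k w.1
  | inr k => coord (frame a.2 x) k w.2
  end.

Lemma dsum_frameE a x k : tnth (dsum_frame a x) k = match fintype.split k with
  | inl k => (tnth (frame a.1 x) k, 0)
  | inr k => (0, tnth (frame a.2 x) k)
  end.
Proof.
rewrite -[k in LHS]splitK; case: (fintype.split k) => l.
  by rewrite tnth_lshift tnth_map.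
by rewrite tnth_rshift tnth_map.
Qed.

Lemma dsum_basisP a x : fdom a.1 x -> fdom a.2 x ->
  basis_of fullv (dsum_frame a x) /\
  forall k w, coord (dsum_frame a x) k w = dsum_coord a k w.
Proof.
move=> ax bx; apply: basis_coordP => [k c u v|[u v]|k l].
- by rewrite /dsum_coord; case: (fintype.split k) => l; rewrite linearP.
- rewrite big_split_ord /=.
  rewrite (eq_bigr (fun k =>
    (coord (frame a.1 x) k u *: tnth (frame a.1 x) k, 0))); last first.
    move=> k _; rewrite dsum_frameE /dsum_coord (unsplitK (inl _ k)).
    by congr pair; rewrite /= scaler0.
  rewrite [X in _ + X](eq_bigr (fun k =>
    (0, coord (frame a.2 x) k v *: tnth (frame a.2 x) k))); last first.
    move=> k _; rewrite dsum_frameE /dsum_coord (unsplitK (inr _ k)).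
    by congr pair; rewrite /= scaler0.
  rewrite [LHS]surjective_pairing [RHS]surjective_pairing /=.
  rewrite !(raddf_sum fst) !(raddf_sum snd) /=.
  by rewrite !big1_eq addr0 add0r -!frame_span.
- rewrite dsum_frameE /dsum_coord -(inj_eq (can_inj splitK)).
  case: (fintype.split k) => i; case: (fintype.split l) => j /=; rewrite ?linear0 //.
    by rewrite frame_delta.
  by rewrite frame_delta.
Qed.

Lemma dsum_open (a : fidx E * fidx F) : open (fdom a.1 `&` fdom a.2).
Proof. by apply: openI; exact: fdom_open. Qed.

Lemma dsum_cover x : exists a : fidx E * fidx F, (fdom a.1 `&` fdom a.2) x.
Proof.
have [a ax] := fdom_cover E x; have [b bx] := fdom_cover F x.
by exists (a, b).
Qed.

Lemma dsum_basis (a : fidx E * fidx F) x : (fdom a.1 `&` fdom a.2) x ->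
  basis_of fullv (dsum_frame a x).
Proof. by case=> ax bx; have [] := dsum_basisP ax bx. Qed.

Lemma dsum_holo (a b : fidx E * fidx F) k l :
  holo_on ((fdom a.1 `&` fdom a.2) `&` (fdom b.1 `&` fdom b.2))
    (fun x => coord (dsum_frame a x) k (tnth (dsum_frame b x) l)).
Proof.
move=> x Dx.
apply: (@holo_at_near _ _ x _ (fun y => dsum_coord a k (tnth (dsum_frame b y) l))
  (fun=> 1) ((fdom a.1 `&` fdom a.2) `&` (fdom b.1 `&` fdom b.2))) => //.
- by apply: openI; exact: dsum_open.
- exact: holo_at_cst.
- exact: oner_neq0.
- by move=> y [[a1 a2] _] _; have [_ ->] := dsum_basisP a1 a2.
case: Dx => -[a1 a2] [b1 b2].
rewrite /dsum_coord; case skE: (fintype.split k) => [i|i]; case slE: (fintype.split l) => [j|j].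
- rewrite (_ : (fun _ => _) =
    fun y => coord (frame a.1 y) i (tnth (frame b.1 y) j)).
    exact: frame_holo.
  by apply/funext => y; rewrite dsum_frameE slE.
- rewrite (_ : (fun _ => _) = fun=> 0); first exact: holo_at_cst.
  by apply/funext => y; rewrite dsum_frameE slE /= linear0.
- rewrite (_ : (fun _ => _) = fun=> 0); first exact: holo_at_cst.
  by apply/funext => y; rewrite dsum_frameE slE /= linear0.
- rewrite (_ : (fun _ => _) =
    fun y => coord (frame a.2 y) i (tnth (frame b.2 y) j)).
    exact: frame_holo.
  by apply/funext => y; rewrite dsum_frameE slE.
Qed.

Definition dsum_bundle : bundle X :=
  @Bundle R X (fun x => (fib E x * fib F x)%type) (rk E + rk F) _ _ _
    dsum_open dsum_cover dsum_basis dsum_holo.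

End Dsum.

Section Dual.
Variable E : bundle X.

Definition dual_frame (a : fidx E) x : (rk E).-tuple 'Hom(fib E x, C^o) :=
  [tuple linfun (coord (frame a x) k : fib E x -> C^o) | k < rk E].

Lemma dual_frameE a x k v :
  tnth (dual_frame a x) k v = coord (frame a x) k v.
Proof.
rewrite tnth_mktuple.
pose f : {linear fib E x -> C^o} := HB.pack (coord (frame a x) k : fib E x -> C^o)
  (GRing.isLinear.Build _ _ _ _ (coord (frame a x) k : fib E x -> C^o)
     (fun c u v => linearP (coord (frame a x) k) c u v)).
exact: (lfunE f).
Qed.

Lemma dual_basisP a x : fdom a x -> basis_of fullv (dual_frame a x) /\
  forall k (t : 'Hom(fib E x, C^o)),
    coord (dual_frame a x) k t = t (tnth (frame a x) k).
Proof.
move=> ax; apply: basis_coordP => [k c s t|t|k l].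
- by rewrite add_lfunE scale_lfunE.
- apply/lfunP => v; rewrite sum_lfunE {1}(frame_span v ax) linear_sum /=.
  apply: eq_bigr => k _; rewrite scale_lfunE dual_frameE linearZ /=.
  exact: mulrC.
- by rewrite dual_frameE frame_delta // eq_sym.
Qed.

Lemma dual_holo a b k l : holo_on (fdom a `&` fdom b)
  (fun x => coord (dual_frame a x) k (tnth (dual_frame b x) l)).
Proof.
move=> x [ax bx].
apply: (@holo_at_near _ _ x _ (fun y => coord (frame b y) l (tnth (frame a y) k))
  (fun=> 1) (fdom a)) => //.
- exact: fdom_open.
- exact: holo_at_cst.
- exact: oner_neq0.
- by move=> y ay _; have [_ ->] := dual_basisP ay; rewrite dual_frameE.
- exact: frame_holo.
Qed.

Definition dual_bundle : bundle X :=
  @Bundle R X (fun x => 'Hom(fib E x, C^o)) (rk E) _ _ _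
    (@fdom_open R X E) (@fdom_cover R X E)
    (fun a x ax => (dual_basisP ax).1) dual_holo.

End Dual.

Definition zero_frame (a : unit) (x : X) : 0.-tuple 'rV[C]_0 := [tuple].

Lemma zero_cover (x : X) : exists a : unit, [set: X] x.
Proof. by exists tt. Qed.

Lemma zero_basis a x : [set: X] x -> basis_of fullv (zero_frame a x).
Proof.
move=> _; have -> : fullv = 0%VS :> {vspace 'rV[C]_0}; last exact: nil_basis.
by apply/vspaceP => v; rewrite memvf memv0 thinmx0 eqxx.
Qed.

Lemma zero_holo (a b : unit) (k l : 'I_0) : holo_on ([set: X] `&` [set: X])
  (fun x => coord (zero_frame a x) k (tnth (zero_frame b x) l)).
Proof. by case: k. Qed.

Definition zero_bundle : bundle X :=
  @Bundle R X (fun=> 'rV[C]_0) 0 unit _ _ (fun=> openT)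
    zero_cover zero_basis zero_holo.

Record subbundle (E : bundle X) := Subbundle {
  sub_fib :> forall x, {vspace fib E x};
  sub_rk : nat;
  sub_frame : forall p, exists (V : set X) (s : forall x, sub_rk.-tuple (fib E x)),
    [/\ open V, V p, forall x, V x -> basis_of (sub_fib x) (s x)
      & forall k, holo_section V (fun x => tnth (s x) k)] }.

(* The holomorphic structure of a subbundle: all its local holomorphic frames *)
Section SubBundle.
Variables (E : bundle X) (W : subbundle E).

Record lframe := LFrame {
  lf_dom : set X;
  lf_fr : forall x, (sub_rk W).-tuple (fib E x);
  lf_open : open lf_dom;
  lf_basis : forall x, lf_dom x -> basis_of (W x) (lf_fr x);
  lf_holo : forall k, holo_section lf_dom (fun x => tnth (lf_fr x) k) }.

Definition lf_frame (a : lframe) x : (sub_rk W).-tuple (subvs_of (W x)) :=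
  map_tuple (vsproj (W x)) (lf_fr a x).

Lemma lf_frameE a x k : lf_dom a x ->
  vsval (tnth (lf_frame a x) k) = tnth (lf_fr a x) k.
Proof.
move=> ax; rewrite tnth_map vsprojK //.
by apply: (basis_mem (lf_basis ax)); rewrite mem_tnth.
Qed.

Lemma lf_basisP a x : lf_dom a x -> basis_of fullv (lf_frame a x) /\
  forall k (v : subvs_of (W x)),
    coord (lf_frame a x) k v = coord (lf_fr a x) k (vsval v).
Proof.
move=> ax; apply: basis_coordP => [k c u v|v|k l].
- by rewrite !linearP.
- apply: val_inj; rewrite /= linear_sum /=.
  rewrite {1}(coord_basis (lf_basis ax) (subvsP v)).
  by apply: eq_bigr => k _; rewrite /= lf_frameE // (tnth_nth 0).
- rewrite lf_frameE // (tnth_nth 0) coord_free 1?eq_sym //.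
  exact: basis_free (lf_basis ax).
Qed.

Lemma lf_cover x : exists a, lf_dom a x.
Proof.
have [V [s [oV Vx bs hs]]] := sub_frame W x.
by exists (LFrame oV bs hs).
Qed.

Lemma lframe_holo a b k l : holo_on (lf_dom a `&` lf_dom b)
  (fun x => coord (lf_frame a x) k (tnth (lf_frame b x) l)).
Proof.
move=> x [ax bx]; have [c cx] := fdom_cover E x.
pose n := sub_rk W; pose r := rk E.
pose mat (d : lframe) y : 'M[C]_(n, r) :=
  \matrix_(i, j) coord (frame c y) j (tnth (lf_fr d y) i).
have mat_holo (d : lframe) : lf_dom d x -> forall i j, holo_at x (fun y => mat d y i j).
  move=> dx i j; rewrite (_ : (fun _ => _) =
    fun y => coord (frame c y) j (tnth (lf_fr d y) i)).
    exact: (lf_holo (l := d)).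
  by apply/funext => y; rewrite mxE.
pose H y : 'M[C]_n := \matrix_(i, j) coord (lf_fr a y) j (tnth (lf_fr b y) i).
have HE y : lf_dom a y -> lf_dom b y -> mat b y = H y *m mat a y.
  move=> ay by_; apply/matrixP => i j; rewrite !mxE.
  have Wb : tnth (lf_fr b y) i \in W y.
    by apply: (basis_mem (lf_basis by_)); rewrite mem_tnth.
  rewrite {1}(coord_basis (lf_basis ay) Wb) linear_sum /=.
  apply: eq_bigr => m _; rewrite !mxE linearZ /=.
  by rewrite (tnth_nth 0 (lf_fr a y)).
have afree : row_free (mat a x).
  rewrite -kermx_eq0; apply/rowV0P => u /sub_kermxP u0.
  have s0 : \sum_i u 0 i *: (lf_fr a x)`_i = 0.
    rewrite (frame_span (\sum_i _) cx) big1 // => j _.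
    rewrite linear_sum /=; move/matrixP/(_ 0 j): u0; rewrite !mxE => u0.
    rewrite (_ : \sum_i _ = 0) ?scale0r // -[RHS]u0.
    by apply: eq_bigr => i _; rewrite mxE linearZ /= (tnth_nth 0).
  have /freeP fa := basis_free (lf_basis ax).
  by apply/rowP => i; rewrite mxE (fa _ s0).
pose P := pinvmx (mat a x); pose D y := mat a y *m P.
have Dx : D x = 1%:M by rewrite /D mulmxVp.
have D_holo : forall i j, holo_at x (fun y => D y i j).
  apply: holo_at_mulmx; first exact: mat_holo.
  by move=> i j; exact: holo_at_cst.
have dD_holo : holo_at x (fun y => \det (D y)) by exact: holo_at_det.
apply: (@holo_at_near _ _ x _
  (fun y => (\det (D y))^-1 * ((mat b y *m P) *m \adj (D y)) l k)
  (fun y => \det (D y)) (lf_dom a `&` lf_dom b)) => //.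
- by apply: openI; exact: lf_open.
- by rewrite Dx det1 oner_neq0.
- move=> y [ay by_] D0; have [_ ->] := lf_basisP ay; rewrite lf_frameE //.
  rewrite HE // -(mulmxA (H y)) -/(D y) -(mulmxA (H y)) mul_mx_adj.
  rewrite mul_mx_scalar !mxE.
  by rewrite mulKf.
- apply: holo_atM.
    by apply: holo_atV => //; rewrite Dx det1 oner_neq0.
  apply: holo_at_mulmx; last exact: holo_at_adj.
  apply: holo_at_mulmx; first exact: mat_holo.
  by move=> i j; exact: holo_at_cst.
Qed.

Definition sub_bundle : bundle X :=
  @Bundle R X (fun x => subvs_of (W x)) (sub_rk W) _ _ _
    lf_open lf_cover (fun a x ax => (lf_basisP ax).1) lframe_holo.

End SubBundle.

End Bundles.

(* A holomorphic section of End(E) (x) K: as for holo_form, it is hf i (x) dz_i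
   in the chart i, and the values of hf i outside of cdom i are irrelevant. *)
Record higgs_field (R : realType) (X : riemann_surface R) (E : bundle X) :=
  HiggsField {
  hf :> cidx X -> forall x, 'End(fib E x);
  hf_holo : forall i a k l, holo_on (cdom i `&` fdom a)
    (fun x => coord (frame a x) k (hf i x (tnth (frame a x) l)));
  hf_compat : forall i j x, cdom i x -> cdom j x ->
    hf i x = dchart i j x *: hf j x }.

Record symplectic_form (R : realType) (X : riemann_surface R) (E : bundle X) :=
  SymplecticForm {
  sform : forall x, fib E x -> fib E x -> cplx R;
  sform_linl : forall x (v : fib E x), scalar (fun u : fib E x => sform u v);
  sform_linr : forall x (u : fib E x), scalar (@sform x u);
  sform_alt : forall x (u : fib E x), sform u u = 0;
  sform_nondeg : forall x (u : fib E x), (forall v, sform u v = 0) -> u = 0;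
  sform_holo : forall a k l, holo_on (fdom a)
    (fun x => sform (tnth (frame a x) k) (tnth (frame a x) l)) }.

(* In other words, an Sp(2n)-Higgs bundle *)
Record symplectic_bundle (R : realType) (X : riemann_surface R) (n : nat) :=
  SymplecticBundle {
  sp_bundle : bundle X;
  sp_rk : rk sp_bundle = n.*2;
  sp_form : symplectic_form sp_bundle }.

Record ustar_higgs (R : realType) (X : riemann_surface R) (n : nat) :=
  UstarHiggs {
  us_sp : symplectic_bundle X n;
  us_field : higgs_field (sp_bundle us_sp);
  us_sym : forall i x u v, cdom i x ->
    sform (sp_form us_sp) (us_field i x u) v = sform (sp_form us_sp) u (us_field i x v) }.

Record gl_higgs (R : realType) (X : riemann_surface R) (n : nat) := GLHiggs {
  gl_bundle : bundle X;
  gl_rk : rk gl_bundle = n;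
  gl_field : higgs_field gl_bundle }.

Notation us_bundle H := (sp_bundle (us_sp H)).
Notation us_form H := (sp_form (us_sp H)).

Section Stability.
Variables (R : realType) (X : riemann_surface R).

Definition hf_invariant (E : bundle X) (phi : higgs_field E) (W : subbundle E) :=
  forall i x u, cdom i x -> u \in W x -> phi i x u \in W x.

Definition slope (E : bundle X) : rat := (deg E)%:~R / (rk E)%:R.

Definition gl_stable n (V : gl_higgs X n) :=
  forall V' : subbundle (gl_bundle V),
    (0 < sub_rk V' < rk (gl_bundle V))%N -> hf_invariant (gl_field V) V' ->
    slope (sub_bundle V') < slope (gl_bundle V).

Definition sub_perp (E : bundle X) (Om : symplectic_form E) (W : subbundle E) x :
    set (fib E x) := [set v | forall u, u \in W x -> sform Om u v = 0].

Definition isotropic (E : bundle X) (Om : symplectic_form E) (W : subbundle E) :=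
  forall x, [set` W x] `<=` sub_perp Om W (x:=x).

Definition coisotropic (E : bundle X) (Om : symplectic_form E)
    (W : subbundle E) :=
  forall x, sub_perp Om W (x:=x) `<=` [set` W x].

Definition complementary (E : bundle X) (W W' : subbundle E) :=
  forall x, (W x + W' x)%VS = fullv /\ (W x :&: W' x)%VS = 0%VS.

Variable n : nat.
Implicit Type H : ustar_higgs X n.

Definition us_semistable H := forall W : subbundle (us_bundle H),
  isotropic (us_form H) W -> hf_invariant (us_field H) W ->
  deg (sub_bundle W) <= 0.

Definition us_stable H := us_semistable H /\
  forall W : subbundle (us_bundle H),
    isotropic (us_form H) W -> hf_invariant (us_field H) W ->
    (0 < sub_rk W < rk (us_bundle H))%N -> deg (sub_bundle W) < 0.

Definition us_polystable H := [/\ us_semistable H,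
  forall W : subbundle (us_bundle H),
    isotropic (us_form H) W -> hf_invariant (us_field H) W ->
    (0 < sub_rk W < rk (us_bundle H))%N -> deg (sub_bundle W) = 0 ->
    exists W' : subbundle (us_bundle H),
      [/\ coisotropic (us_form H) W', hf_invariant (us_field H) W',
          (0 < sub_rk W')%N & complementary W W']
& forall W : subbundle (us_bundle H),
    coisotropic (us_form H) W -> hf_invariant (us_field H) W ->
    (0 < sub_rk W < rk (us_bundle H))%N -> deg (sub_bundle W) = 0 ->
    exists W' : subbundle (us_bundle H),
      [/\ isotropic (us_form H) W', hf_invariant (us_field H) W',
          (0 < sub_rk W')%N & complementary W W']].

Definition us_iso m (H : ustar_higgs X n) (H' : ustar_higgs X m) :=
  exists f : forall x,
    'Hom(fib (us_bundle H) x, fib (us_bundle H') x),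
  [/\ forall x, bijective (f x),
      forall a b k l, holo_on (fdom a `&` fdom b)
        (fun x => coord (frame b x) k (f x (tnth (frame a x) l))),
      forall x u v, sform (us_form H') (f x u) (f x v) = sform (us_form H) u v
    & forall i x u, cdom i x ->
        f x (us_field H i x u) = us_field H' i x (f x u)].

End Stability.

Section UstarSum.
Variables (R : realType) (X : riemann_surface R).
Let C := cplx R.

Section PairMap.
Variables (U V : vectType C) (f : 'End(U)) (g : 'End(V)).
Definition pair_fun (w : (U * V)%type) : (U * V)%type := (f w.1, g w.2).
Lemma pair_fun_linear : linear pair_fun.
Proof. by move=> c u v; rewrite /pair_fun /= !linearP. Qed.
HB.instance Definition _ := GRing.isLinear.Build C _ _ _ pair_fun pair_fun_linear.
Definition pair_lfun : 'End((U * V)%type) := linfun pair_fun.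
Lemma pair_lfunE w : pair_lfun w = (f w.1, g w.2).
Proof. by rewrite lfunE. Qed.
End PairMap.

Section TransposeMap.
Variables (V : vectType C) (f : 'End(V)).
Definition tr_fun (t : 'Hom(V, C^o)) : 'Hom(V, C^o) := (t \o f)%VF.
Lemma tr_fun_linear : linear tr_fun.
Proof.
move=> c s t; apply/lfunP => v.
by rewrite /tr_fun comp_lfunE !add_lfunE !scale_lfunE !comp_lfunE.
Qed.
HB.instance Definition _ := GRing.isLinear.Build C _ _ _ tr_fun tr_fun_linear.
Definition tr_lfun : 'End('Hom(V, C^o)) := linfun tr_fun.
Lemma tr_lfunE t v : tr_lfun t v = t (f v).
Proof. by rewrite lfunE /= comp_lfunE. Qed.
End TransposeMap.

Section SumField.
Variables (E F : bundle X) (phi : higgs_field E) (psi : higgs_field F).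

Definition sum_hf i x : 'End(fib (dsum_bundle E F) x) := pair_lfun (phi i x) (psi i x).

Lemma sum_hf_holo i (a : fidx (dsum_bundle E F)) k l : holo_on (cdom i `&` fdom a)
  (fun x => coord (frame a x) k (sum_hf i x (tnth (frame a x) l))).
Proof.
move=> x [ix [a1 a2]].
apply: (@holo_at_near _ _ x _
  (fun y => dsum_coord a k (sum_hf i y (tnth (dsum_frame a y) l)))
  (fun=> 1) (fdom a)) => //.
- exact: (@fdom_open _ _ (dsum_bundle E F)).
- exact: holo_at_cst.
- exact: oner_neq0.
- by move=> y [b1 b2] _; have [_ <-] := dsum_basisP b1 b2.
rewrite /dsum_coord /sum_hf.
case: (fintype.split k) => p; case slE: (fintype.split l) => [q|q].
- rewrite (_ : (fun _ => _) = fun y =>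
    coord (frame a.1 y) p (phi i y (tnth (frame a.1 y) q))).
    exact: hf_holo.
  by apply/funext => y; rewrite pair_lfunE dsum_frameE slE.
- rewrite (_ : (fun _ => _) = fun=> 0); first exact: holo_at_cst.
  by apply/funext => y; rewrite pair_lfunE dsum_frameE slE /= !linear0.
- rewrite (_ : (fun _ => _) = fun=> 0); first exact: holo_at_cst.
  by apply/funext => y; rewrite pair_lfunE dsum_frameE slE /= !linear0.
- rewrite (_ : (fun _ => _) = fun y =>
    coord (frame a.2 y) p (psi i y (tnth (frame a.2 y) q))).
    exact: hf_holo.
  by apply/funext => y; rewrite pair_lfunE dsum_frameE slE.
Qed.

Lemma sum_hf_compat i j x : cdom i x -> cdom j x ->
  sum_hf i x = dchart i j x *: sum_hf j x.
Proof.
move=> ix jx; apply/lfunP => -[u v].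
rewrite scale_lfunE !pair_lfunE /= (hf_compat phi ix jx) (hf_compat psi ix jx).
by rewrite !scale_lfunE.
Qed.

Definition sum_field : higgs_field (dsum_bundle E F) :=
  HiggsField sum_hf_holo sum_hf_compat.

End SumField.
Section TransposeField.
Variables (E : bundle X) (phi : higgs_field E).

Definition tr_hf i x : 'End('Hom(fib E x, C^o)) := tr_lfun (phi i x).

Lemma tr_hf_holo i (a : fidx E) k l : holo_on (cdom i `&` fdom a)
  (fun x => coord (dual_frame a x) k (tr_hf i x (tnth (dual_frame a x) l))).
Proof.
move=> x [ix ax].
apply: (@holo_at_near _ _ x _
  (fun y => coord (frame a y) l (phi i y (tnth (frame a y) k)))
  (fun=> 1) (fdom a)) => //.
- exact: fdom_open.
- exact: holo_at_cst.
- exact: oner_neq0.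
- move=> y ay _; have [_ ->] := dual_basisP ay.
  by rewrite tr_lfunE dual_frameE.
- exact: hf_holo.
Qed.

Lemma tr_hf_compat i j x : cdom i x -> cdom j x ->
  tr_hf i x = dchart i j x *: tr_hf j x.
Proof.
move=> ix jx; apply/lfunP => t; apply/lfunP => v.
by rewrite scale_lfunE scale_lfunE !tr_lfunE (hf_compat phi ix jx) scale_lfunE
  linearZ.
Qed.

Definition tr_field : higgs_field (dual_bundle E) :=
  @HiggsField R X (dual_bundle E) tr_hf tr_hf_holo tr_hf_compat.

End TransposeField.

Section ZeroField.
Variable E : bundle X.

Lemma zero_hf_holo (i : cidx X) (a : fidx E) k l : holo_on (cdom i `&` fdom a)
  (fun x => coord (frame a x) k ((0 : 'End(fib E x)) (tnth (frame a x) l))).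
Proof.
rewrite (_ : (fun _ => _) = fun=> 0) => [|]; first by move=> x _; exact: holo_at_cst.
by apply/funext => x; rewrite zero_lfunE linear0.
Qed.

Lemma zero_hf_compat (i j : cidx X) x : cdom i x -> cdom j x ->
  0 = dchart i j x *: 0 :> 'End(fib E x).
Proof. by rewrite scaler0. Qed.

Definition zero_field : higgs_field E :=
  @HiggsField R X E (fun _ _ => 0) zero_hf_holo zero_hf_compat.

End ZeroField.

Section SumForm.
Variables (E F : bundle X) (Om : symplectic_form E) (Th : symplectic_form F).

Definition sum_form_fun x (w w' : fib (dsum_bundle E F) x) : C :=
  sform Om w.1 w'.1 + sform Th w.2 w'.2.

Lemma sform0l (G : bundle X) (Ps : symplectic_form G) x (v : fib G x) :
  sform Ps 0 v = 0.
Proof.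
have /= := sform_linl Ps v (-1) 0 0.
by rewrite scaler0 addr0 mulN1r addNr.
Qed.

Lemma sform0r (G : bundle X) (Ps : symplectic_form G) x (v : fib G x) :
  sform Ps v 0 = 0.
Proof.
have /= := sform_linr Ps v (-1) 0 0.
by rewrite scaler0 addr0 mulN1r addNr.
Qed.

Lemma sum_form_linl x v : scalar (fun u => @sum_form_fun x u v).
Proof.
move=> c u w; rewrite /sum_form_fun /= (sform_linl Om) (sform_linl Th).
by rewrite mulrDr addrACA.
Qed.

Lemma sum_form_linr x u : scalar (@sum_form_fun x u).
Proof.
move=> c v w; rewrite /sum_form_fun /= (sform_linr Om) (sform_linr Th).
by rewrite mulrDr addrACA.
Qed.

Lemma sum_form_alt x u : @sum_form_fun x u u = 0.
Proof. by rewrite /sum_form_fun !sform_alt addr0. Qed.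

Lemma sum_form_nondeg x u : (forall v, @sum_form_fun x u v = 0) -> u = 0.
Proof.
case: u => u u' uv; congr pair.
  by apply: (@sform_nondeg _ _ _ Om) => v; have := uv (v, 0);
    rewrite /sum_form_fun /= sform0r addr0.
by apply: (@sform_nondeg _ _ _ Th) => v; have := uv (0, v);
  rewrite /sum_form_fun /= sform0r add0r.
Qed.

Lemma sum_form_holo (a : fidx (dsum_bundle E F)) k l : holo_on (fdom a)
  (fun x => sum_form_fun (tnth (frame a x) k) (tnth (frame a x) l)).
Proof.
move=> x [a1 a2]; rewrite /sum_form_fun.
case skE: (fintype.split k) => [p|p]; case slE: (fintype.split l) => [q|q].
- rewrite (_ : (fun _ => _) = fun y =>
    sform Om (tnth (frame a.1 y) p) (tnth (frame a.1 y) q)).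
    exact: sform_holo.
  by apply/funext => y; rewrite !dsum_frameE skE slE /= sform0l addr0.
- rewrite (_ : (fun _ => _) = fun=> 0); first exact: holo_at_cst.
  by apply/funext => y; rewrite !dsum_frameE skE slE /= sform0l sform0r addr0.
- rewrite (_ : (fun _ => _) = fun=> 0); first exact: holo_at_cst.
  by apply/funext => y; rewrite !dsum_frameE skE slE /= sform0l sform0r addr0.
- rewrite (_ : (fun _ => _) = fun y =>
    sform Th (tnth (frame a.2 y) p) (tnth (frame a.2 y) q)).
    exact: sform_holo.
  by apply/funext => y; rewrite !dsum_frameE skE slE /= sform0l add0r.
Qed.

Definition sum_form : symplectic_form (dsum_bundle E F) :=
  SymplecticForm sum_form_linl sum_form_linr sum_form_alt sum_form_nondeg
    sum_form_holo.

End SumForm.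

Section StandardForm.
Variable E : bundle X.

Definition std_form_fun x (w w' : fib (dsum_bundle E (dual_bundle E)) x) : C :=
  w'.2 w.1 - w.2 w'.1.

Lemma std_form_linl x v : scalar (fun u => @std_form_fun x u v).
Proof.
move=> c u w; rewrite /std_form_fun /= linearP add_lfunE scale_lfunE /=.
by rewrite mulrBr opprD addrACA.
Qed.

Lemma std_form_linr x u : scalar (@std_form_fun x u).
Proof.
move=> c v w; rewrite /std_form_fun /= linearP add_lfunE scale_lfunE /=.
by rewrite mulrBr opprD addrACA.
Qed.

Lemma std_form_alt x u : @std_form_fun x u u = 0.
Proof. by rewrite /std_form_fun subrr. Qed.

Lemma std_form_nondeg x u : (forall v, @std_form_fun x u v = 0) -> u = 0.
Proof.
case: u => u t ut; congr pair; last first.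
  apply/lfunP => v; have := ut (v, 0).
  by rewrite /std_form_fun /= zero_lfunE sub0r zero_lfunE => /eqP;
    rewrite oppr_eq0 => /eqP.
have [a ax] := fdom_cover E x.
rewrite (frame_span u ax) big1 // => k _.
have := ut (0, tnth (dual_frame a x) k).
by rewrite /std_form_fun /= linear0 subr0 dual_frameE => ->; rewrite scale0r.
Qed.

Lemma std_form_holo (a : fidx (dsum_bundle E (dual_bundle E))) k l : holo_on (fdom a)
  (fun x => std_form_fun (tnth (frame a x) k) (tnth (frame a x) l)).
Proof.
move=> x [a1 a2]; rewrite /std_form_fun.
case skE: (fintype.split k) => [p|p]; case slE: (fintype.split l) => [q|q].
- rewrite (_ : (fun _ => _) = fun=> 0); first exact: holo_at_cst.
  by apply/funext => y; rewrite !dsum_frameE skE slE /= !zero_lfunE subr0.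
- rewrite (_ : (fun _ => _) = fun y =>
    coord (@frame R X E a.2 y) q (tnth (@frame R X E a.1 y) p)).
    exact: frame_holo.
  by apply/funext => y; rewrite !dsum_frameE skE slE /= zero_lfunE subr0
    dual_frameE.
- rewrite (_ : (fun _ => _) = fun y =>
    - coord (@frame R X E a.2 y) p (tnth (@frame R X E a.1 y) q)).
    by apply: holo_atN; exact: frame_holo.
  by apply/funext => y; rewrite !dsum_frameE skE slE /= zero_lfunE sub0r
    dual_frameE.
- rewrite (_ : (fun _ => _) = fun=> 0); first exact: holo_at_cst.
  by apply/funext => y; rewrite !dsum_frameE skE slE /= !linear0 addr0.
Qed.

(* The pairing ((v, s), (w, t)) |-> t(v) - s(w) on E (+) E^* *)
Definition std_form : symplectic_form (dsum_bundle E (dual_bundle E)) :=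
  SymplecticForm std_form_linl std_form_linr std_form_alt std_form_nondeg
    std_form_holo.

End StandardForm.

Section ZeroForm.

Definition zero_form_fun x (u v : fib (zero_bundle X) x) : C := 0.

Lemma zero_form_linl x v : scalar (fun u => @zero_form_fun x u v).
Proof. by move=> c u w; rewrite /zero_form_fun mulr0 addr0. Qed.

Lemma zero_form_linr x u : scalar (@zero_form_fun x u).
Proof. by move=> c v w; rewrite /zero_form_fun mulr0 addr0. Qed.

Lemma zero_form_nondeg x (u : fib (zero_bundle X) x) :
  (forall v, zero_form_fun u v = 0) -> u = 0.
Proof. by move=> _; exact: thinmx0. Qed.

Definition zero_form : symplectic_form (zero_bundle X) :=
  @SymplecticForm R X (zero_bundle X) zero_form_fun zero_form_linl
    zero_form_linr (fun _ _ => erefl) zero_form_nondeg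
    (fun a k l x _ => @holo_at_cst R X x 0).

End ZeroForm.

Section Constructions.

Lemma us_sum_rk m n (S : symplectic_bundle X m) (T : symplectic_bundle X n) :
  rk (dsum_bundle (sp_bundle S) (sp_bundle T)) = (m + n).*2.
Proof. by rewrite /= !sp_rk doubleD. Qed.

Lemma us_sum_sym m n (H : ustar_higgs X m) (H' : ustar_higgs X n) i x
    (u v : fib (dsum_bundle (us_bundle H) (us_bundle H')) x) : cdom i x ->
  sform (sum_form (us_form H) (us_form H'))
    (sum_field (us_field H) (us_field H') i x u) v =
  sform (sum_form (us_form H) (us_form H'))
    u (sum_field (us_field H) (us_field H') i x v).
Proof.
move=> ix; rewrite /= /sum_form_fun /= /sum_hf !pair_lfunE /=.
by rewrite !us_sym.
Qed.

Definition us_sum m n (H : ustar_higgs X m) (H' : ustar_higgs X n) :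
    ustar_higgs X (m + n) :=
  @UstarHiggs R X (m + n)
    (SymplecticBundle (us_sum_rk (us_sp H) (us_sp H'))
       (sum_form (us_form H) (us_form H')))
    (sum_field (us_field H) (us_field H')) (@us_sum_sym m n H H').

Lemma us_of_sp_sym n (S : symplectic_bundle X n) i x
    (u v : fib (sp_bundle S) x) : cdom i x ->
  sform (sp_form S) (zero_field (sp_bundle S) i x u) v =
  sform (sp_form S) u (zero_field (sp_bundle S) i x v).
Proof. by move=> ix; rewrite /= !zero_lfunE sform0l sform0r. Qed.

Definition us_of_sp n (S : symplectic_bundle X n) : ustar_higgs X n :=
  UstarHiggs (@us_of_sp_sym n S).

Definition us_zero : ustar_higgs X 0 :=
  us_of_sp (@SymplecticBundle R X 0 (zero_bundle X) erefl zero_form).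

Lemma us_of_gl_rk n (V : gl_higgs X n) :
  rk (dsum_bundle (gl_bundle V) (dual_bundle (gl_bundle V))) = n.*2.
Proof. by rewrite /= gl_rk addnn. Qed.

Lemma us_of_gl_sym n (V : gl_higgs X n) i x
    (u v : fib (dsum_bundle (gl_bundle V) (dual_bundle (gl_bundle V))) x) : cdom i x ->
  sform (std_form (gl_bundle V))
    (sum_field (gl_field V) (tr_field (gl_field V)) i x u) v =
  sform (std_form (gl_bundle V))
    u (sum_field (gl_field V) (tr_field (gl_field V)) i x v).
Proof.
move=> ix; rewrite /= /std_form_fun /= /sum_hf !pair_lfunE /=.
by rewrite /tr_hf !tr_lfunE.
Qed.

Definition us_of_gl n (V : gl_higgs X n) : ustar_higgs X n :=
  @UstarHiggs R X n
    (SymplecticBundle (us_of_gl_rk V) (std_form (gl_bundle V)))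
    (sum_field (gl_field V) (tr_field (gl_field V))) (@us_of_gl_sym n V).

(* A U(n)-Higgs bundle is just a vector bundle of rank n. *)
Definition gl_of_u n (E : bundle X) (rkE : rk E = n) : gl_higgs X n :=
  GLHiggs rkE (zero_field E).

Fixpoint us_bigsum (s : seq {m : nat & ustar_higgs X m}) :
    ustar_higgs X (sumn [seq tag H | H <- s]) :=
  match s with
  | [::] => us_zero
  | H :: s' => us_sum (tagged H) (us_bigsum s')
  end.

Variant stable_summand (m : nat) : ustar_higgs X m -> Prop :=
| SummandUstar (H : ustar_higgs X m) : us_stable H -> stable_summand H
| SummandGL (V : gl_higgs X m) : gl_stable V -> stable_summand (us_of_gl V)
| SummandSp (S : symplectic_bundle X m) :
    us_stable (us_of_sp S) -> stable_summand (us_of_sp S)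
| SummandU (E : bundle X) (rkE : rk E = m) :
    gl_stable (gl_of_u rkE) -> stable_summand (us_of_gl (gl_of_u rkE)).

End Constructions.
End UstarSum.

(* Main.v *)
Require Import Defs.
From Stdlib Require List.
From HB Require Import structures.
From mathcomp Require Import all_boot all_order all_algebra.
From mathcomp Require Import classical_sets reals topology.
From mathcomp Require Import boolp normedtype derive ring.

(** The decomposition is found by splitting off, again and again, the pair
    [N (+) N^*] spanned by a smallest obstruction [N] to stability.

    Suppose that [(W, Omega, phi)] is polystable but not stable. Then some
    nonzero isotropic [phi]-invariant subbundle has degree 0; let [N] be one of
    smallest rank. Polystability gives an invariant coisotropic complement of
    [N], that is, a holomorphic projector [p] onto [N] that commutes with [phi]
    and whose kernel is coisotropic. Let [p'] be the adjoint of [p] for [Omega].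
    That [N] is isotropic means [p' p = 0], that the kernel of [p] is coisotropic
    means [p p' = 0], so [p + p'] is a self-adjoint projector and
    [q = 1 - p - p'] is the orthogonal projector onto [M = (N (+) im p')^perp].
    The pairing given by [Omega] identifies [im p'] with [N^*], and the map
    [w |-> ((p w, Omega(., w) on N), q w)] is an isomorphism of [W] with the sum of
    the Higgs bundle that [N] defines and of [M] ([us_iso_split]).

    The bundle [N] is stable: its invariant subbundles are isotropic in [W],
    hence of degree at most 0, and the degree 0 is excluded by minimality
    ([sub_higgs_stable]). To apply induction to [M], one needs that every
    isotropic invariant subbundle [V] of [M] of degree 0 again has a projector
    with coisotropic kernel. Semistability passes from [W] to [M], and if [r] is
    such a projector for [V] in [W], with adjoint [r'], then
    [r q - (r q r') / 2] is one in [M] ([orth_splitting]); the correction term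
    is the usual one that moves a complement of a Lagrangian subspace to a
    Lagrangian complement. The induction therefore runs on the existence of such
    projectors ([splitting_property]), which follows at once from
    polystability ([polystable_splitting]).

    Working with projectors reduces the holomorphic side to three facts. A
    holomorphic section of the target of a fibrewise injective map, lifted
    through this map, stays holomorphic ([hol_vec_cancel]): this yields inverses,
    adjoints, projections along a complement and corestrictions to subbundles.
    The image of a holomorphic projector of constant rank is a subbundle
    ([proj_image]). The degree only depends on the isomorphism class of the
    bundle ([deg_iso]), so that it can be computed in any bundle that contains
    the given one. *)

Set Implicit Arguments.
Unset Strict Implicit.
Unset Printing Implicit Defensive.

Import Order.TTheory GRing.Theory Num.Theory.
Import numFieldNormedType.Exports.

(** * Linear algebra *)

Section LinearMaps.
Local Open Scope ring_scope.
Variable K : fieldType.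

Section Pairing.
Variables (A U V : vectType K) (f : 'Hom(A, U)) (g : 'Hom(A, V)).
Definition lpair_fun w : (U * V)%type := (f w, g w).
Lemma lpair_fun_linear : linear lpair_fun.
Proof. by move=> c u v; rewrite /lpair_fun !linearP. Qed.
HB.instance Definition _ :=
  GRing.isLinear.Build K _ _ _ lpair_fun lpair_fun_linear.
Definition lpair : 'Hom(A, (U * V)%type) := linfun lpair_fun.
Lemma lpairE w : lpair w = (f w, g w).
Proof. by rewrite lfunE. Qed.
End Pairing.

Section Precomposition.
Variables (U V : vectType K) (f : 'Hom(U, V)).
Definition precomp_fun (t : 'Hom(V, K^o)) : 'Hom(U, K^o) := (t \o f)%VF.
Lemma precomp_fun_linear : linear precomp_fun.
Proof.
move=> c s t; apply/lfunP => v.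
by rewrite /precomp_fun comp_lfunE !add_lfunE !scale_lfunE !comp_lfunE.
Qed.
HB.instance Definition _ :=
  GRing.isLinear.Build K _ _ _ precomp_fun precomp_fun_linear.
Definition precomp := linfun precomp_fun.
Lemma precompE t u : precomp t u = t (f u).
Proof. by rewrite lfunE /= comp_lfunE. Qed.
End Precomposition.

Lemma dim_dual (V : vectType K) : \dim {: 'Hom(V, K^o)} = \dim {: V}.
Proof. by rewrite !dimvf /dim /= muln1. Qed.

Lemma dim_sub (V : vectType K) (U : {vspace V}) : \dim {: subvs_of U} = \dim U.
Proof. by rewrite dimvf. Qed.

Lemma lfun_bij (U V : vectType K) (f : 'Hom(U, V)) :
  injective f -> \dim {: U} = \dim {: V} ->
  cancel f f^-1%VF /\ cancel f^-1%VF f.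
Proof.
move=> finj dUV; have kf : lker f == 0%VS by apply/lker0P.
have lf : limg f = fullv.
  by apply/eqP; rewrite eqEdim subvf /= limg_dim_eq ?dUV // (eqP kf) capv0.
by split=> v; [rewrite lker0_lfunK|rewrite limg_lfunVK // lf memvf].
Qed.
End LinearMaps.

(** * Holomorphic sections and holomorphic maps *)

Section HolomorphicSections.
Local Open Scope classical_set_scope.
Local Open Scope ring_scope.
Variables (R : realType) (X : riemann_surface R).
Let C := cplx R.

Lemma holo_at_continuous x (f : X -> C) : holo_at x f -> {for x, continuous f}.
Proof.
move=> hf; have [i ix] := cdom_cover x.
have gc : {for chart i x, continuous (f \o @chart_inv R X i)}.
  by apply: differentiable_continuous; apply/derivable1_diffP; exact: hf.
have hc : (f \o @chart_inv R X i) \o chart i @ x --> f x.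
  rewrite -[in X in _ --> X](chartK ix).
  exact: continuous_comp (chart_continuous ix) gc.
apply: cvg_trans hc; apply: near_eq_cvg.
have : nbhs x (cdom i) by apply: open_nbhs_nbhs; split => //; exact: cdom_open.
by apply: filterS => y iy; rewrite /= chartK.
Qed.

Lemma open_holo_neq0 (U : set X) (f : X -> C) : open U -> holo_on U f ->
  open (U `&` [set y | f y != 0]).
Proof.
move=> oU hf; rewrite openE => x [Ux fx].
apply: filterI; first by apply: open_nbhs_nbhs.
apply: (cvgr_neq0 _ (holo_at_continuous (hf x Ux))) => //.
Qed.

Lemma holo_at_eq_near x (f g : X -> C) (U : set X) : open U -> U x ->
  (forall y, U y -> f y = g y) -> holo_at x g -> holo_at x f.
Proof.
move=> oU Ux fg hg.
refine (@holo_at_near R X x f g (fun=> 1) U oU Ux (@holo_at_cst R X x 1) _ _ hg).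
  exact: oner_neq0.
by move=> y Uy _; exact: fg.
Qed.

Definition hol_vec (E : bundle X) (s : forall x, fib E x) x :=
  forall a k, fdom a x -> holo_at x (fun y => coord (frame a y) k (s y)).

(** Holomorphy of a family of maps is tested on all holomorphic sections, rather
    than on frames: composites are then holomorphic by definition, and
    [hol_hom_frame] recovers the usual test for linear maps. *)
Definition hol_hom (E F : bundle X) (f : forall x, fib E x -> fib F x) x :=
  forall s, hol_vec s x -> hol_vec (fun y => f y (s y)) x.

Lemma holo_sectionP (E : bundle X) (U : set X) (s : forall x, fib E x) :
  holo_section U s <-> forall x, U x -> hol_vec s x.
Proof.
split=> [hs x Ux a k ax|hs a k x [Ux ax]]; first exact: hs.
exact: hs.
Qed.

Section Sections.
Variable E : bundle X.
Implicit Types s t : forall x, fib E x.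

Lemma hol_vec_near x s t (U : set X) : open U -> U x ->
  (forall y, U y -> s y = t y) -> hol_vec t x -> hol_vec s x.
Proof.
move=> oU Ux st ht a k ax; apply: (holo_at_eq_near oU Ux _ (ht a k ax)).
by move=> y Uy; rewrite st.
Qed.

Lemma hol_vecZ x (c : X -> C) s : holo_at x c -> hol_vec s x ->
  hol_vec (fun y => c y *: s y) x.
Proof.
move=> hc hs a k ax.
rewrite (_ : (fun _ => _) = fun y => c y * coord (frame a y) k (s y)).
  exact: holo_atM hc (hs a k ax).
by apply/funext => y; rewrite linearZ.
Qed.

Lemma hol_vecD x s t : hol_vec s x -> hol_vec t x ->
  hol_vec (fun y => s y + t y) x.
Proof.
move=> hs ht a k ax.
rewrite (_ : (fun _ => _) = fun y =>
  coord (frame a y) k (s y) + coord (frame a y) k (t y)).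
  by apply: holo_atD; [exact: hs|exact: ht].
by apply/funext => y; rewrite linearD.
Qed.

Lemma hol_vec0 x : hol_vec (fun y => 0 : fib E y) x.
Proof.
move=> a k ax.
rewrite (_ : (fun _ => _) = fun=> 0); first exact: holo_at_cst.
by apply/funext => y; rewrite linear0.
Qed.

Lemma hol_vecB x s t : hol_vec s x -> hol_vec t x ->
  hol_vec (fun y => s y - t y) x.
Proof.
move=> hs ht.
rewrite (_ : (fun _ => _) = fun y => s y + (-1) *: t y).
  exact: hol_vecD hs (hol_vecZ (@holo_at_cst R X x _) ht).
by apply: functional_extensionality_dep => y; rewrite scaleN1r.
Qed.

Lemma hol_vec_sum x I (r : seq I) (s : I -> forall x, fib E x) :
  (forall i, hol_vec (s i) x) -> hol_vec (fun y => \sum_(i <- r) s i y) x.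
Proof.
move=> hs; elim: r => [|i r IH].
  rewrite (_ : (fun _ => _) = fun y => 0); first exact: hol_vec0.
  by apply: functional_extensionality_dep => y; rewrite big_nil.
rewrite (_ : (fun _ => _) = fun y => s i y + \sum_(i <- r) s i y).
  exact: hol_vecD (hs i) IH.
by apply: functional_extensionality_dep => y; rewrite big_cons.
Qed.

Lemma hol_vec_frame x a k : fdom a x -> hol_vec (fun y => tnth (@frame R X E a y) k) x.
Proof. by move=> ax b l bx; apply: frame_holo. Qed.

(** Near [x] a section is the combination of the vectors of a frame, with its
    own coordinates as coefficients: one frame detects holomorphy. *)
Lemma hol_vec1 x s a : fdom a x ->
  (forall k, holo_at x (fun y => coord (frame a y) k (s y))) -> hol_vec s x.
Proof.
move=> ax hs; apply: (@hol_vec_near x _ (fun y =>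
    \sum_k coord (frame a y) k (s y) *: tnth (@frame R X E a y) k) (fdom a)) => //.
- exact: fdom_open.
- by move=> y ay; exact: frame_span.
by apply: hol_vec_sum => k; apply: hol_vecZ => //; exact: hol_vec_frame.
Qed.

End Sections.

Lemma hol_hom_frame (E F : bundle X) (f : forall x, 'Hom(fib E x, fib F x)) x a :
  fdom a x -> (forall l, hol_vec (fun y => f y (tnth (@frame R X E a y) l)) x) ->
  hol_hom (fun y => f y) x.
Proof.
move=> ax hf s hs; apply: (@hol_vec_near _ x _ (fun y =>
    \sum_k coord (frame a y) k (s y) *: f y (tnth (@frame R X E a y) k)) (fdom a)) => //.
- exact: fdom_open.
- move=> y ay; rewrite {1}(frame_span (s y) ay) linear_sum.
  by apply: eq_bigr => k _; rewrite linearZ.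
by apply: hol_vec_sum => k; apply: hol_vecZ => //; exact: hs.
Qed.

Lemma hol_homP (E F : bundle X) (f : forall x, 'Hom(fib E x, fib F x)) x :
  (forall a b k l, fdom a x -> fdom b x ->
     holo_at x (fun y => coord (frame b y) k (f y (tnth (@frame R X E a y) l)))) <->
  hol_hom (fun y => f y) x.
Proof.
split=> [hf|hf a b k l ax bx].
  have [a ax] := fdom_cover E x.
  by apply: (hol_hom_frame ax) => l b k bx; exact: hf.
exact: hf (hol_vec_frame ax) _ _ bx.
Qed.

(** Let [A] be the matrix of [f] in local frames, acting on rows. The rows of
    [A x] are free, so [A x] has a right inverse [P]; near [x] the matrix [A P] is
    still invertible, and Cramer's rule writes the coordinates of [s] as rational
    functions of those of [f s] and of the entries of [A P]. *)
Lemma hol_vec_cancel (E F : bundle X) (f : forall x, 'Hom(fib E x, fib F x)) x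
    (s : forall x, fib E x) :
  hol_hom (fun y => f y) x -> injective (f x) ->
  hol_vec (fun y => f y (s y)) x -> hol_vec s x.
Proof.
move=> hf finj hfs.
have [a ax] := fdom_cover E x; have [b bx] := fdom_cover F x.
pose A y : 'M[C]_(rk E, rk F) :=
  \matrix_(i, j) coord (frame b y) j (f y (tnth (frame a y) i)).
pose S y : 'rV[C]_(rk E) := \row_i coord (frame a y) i (s y).
pose T y : 'rV[C]_(rk F) := \row_j coord (frame b y) j (f y (s y)).
have hA i j : holo_at x (fun y => A y i j).
  rewrite (_ : (fun _ => _) = fun y => coord (frame b y) j (f y (tnth (frame a y) i))).
    by apply: hf => //; exact: hol_vec_frame.
  by apply/funext => y; rewrite mxE.
have hT i j : holo_at x (fun y => T y i j).
  rewrite (_ : (fun _ => _) = fun y => coord (frame b y) j (f y (s y))).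
    exact: hfs.
  by apply/funext => y; rewrite mxE.
have TE y : fdom a y -> T y = S y *m A y.
  move=> ay; apply/rowP => j; rewrite !mxE {1}(frame_span (s y) ay) !linear_sum.
  by apply: eq_bigr => k _; rewrite /= !mxE !linearZ.
have Afree : row_free (A x).
  rewrite -kermx_eq0; apply/rowV0P => u /sub_kermxP u0.
  pose v := \sum_i u 0 i *: tnth (@frame R X E a x) i.
  have fv : f x v = 0.
    rewrite (frame_span (f x v) bx) big1 // => j _.
    have -> : coord (frame b x) j (f x v) = (u *m A x) 0 j.
      rewrite !linear_sum mxE; apply: eq_bigr => i _.
      by rewrite /= !mxE !linearZ.
    by rewrite u0 mxE scale0r.
  have v0 : v = 0 by apply: finj; rewrite fv linear0.
  apply/rowP => i; rewrite mxE -[RHS](linear0 (coord (frame a x) i)) -v0.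
  rewrite linear_sum (bigD1 i) //= linearZ /= frame_delta // eqxx mulr1.
  rewrite big1 ?addr0 // => j ji.
  by rewrite linearZ /= frame_delta // eq_sym (negbTE ji) mulr0.
pose P := pinvmx (A x); pose D y := A y *m P.
have Dx : D x = 1%:M by rewrite /D mulmxVp.
have hD : forall i j, holo_at x (fun y => D y i j).
  apply: holo_at_mulmx => // i j; exact: holo_at_cst.
(* Near [x], [S = T P (A P)^-1], with the inverse given by the adjugate. *)
have hdD : holo_at x (fun y => \det (D y)) by exact: holo_at_det.
apply: (hol_vec1 ax) => k.
apply: (@holo_at_near _ _ x _
  (fun y => (\det (D y))^-1 * ((T y *m P) *m \adj (D y)) 0 k)
  (fun y => \det (D y)) (fdom a)).
- exact: fdom_open.
- exact: ax.
- exact: hdD.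
- by rewrite Dx det1 oner_neq0.
- move=> y ay D0; rewrite TE // -(mulmxA (S y)) -/(D y) -(mulmxA (S y)) mul_mx_adj.
  by rewrite mul_mx_scalar !mxE mulKf.
- apply: holo_atM.
    by apply: holo_atV => //; rewrite Dx det1 oner_neq0.
  apply: holo_at_mulmx; last exact: holo_at_adj.
  apply: holo_at_mulmx; first exact: hT.
  by move=> i j; exact: holo_at_cst.
Qed.

Lemma hol_vec_pair (E F : bundle X) (s : forall x, fib E x) (t : forall x, fib F x) x :
  hol_vec s x -> hol_vec t x ->
  hol_vec (E := dsum_bundle E F) (fun y => (s y, t y)) x.
Proof.
move=> hs ht; have [[a b] /= [ax bx]] := dsum_cover E F x.
apply: (@hol_vec1 (dsum_bundle E F) x _ (a, b)) => // k.
apply: (@holo_at_eq_near x _ (fun y => dsum_coord (a, b) k (s y, t y))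
  (fdom a `&` fdom b)) => //.
- exact: (@dsum_open _ _ E F (a, b)).
- by move=> y [ay b_y]; have [_ ->] := @dsum_basisP _ _ E F (a, b) y ay b_y.
by rewrite /dsum_coord; case: (fintype.split k) => l; [exact: hs|exact: ht].
Qed.

Lemma hol_vec_fst (E F : bundle X) (s : forall x, fib (dsum_bundle E F) x) x :
  hol_vec s x -> hol_vec (fun y => (s y).1) x.
Proof.
move=> hs; have [[a b] /= [ax bx]] := dsum_cover E F x.
apply: (hol_vec1 ax) => k.
apply: (holo_at_eq_near _ _ _ (hs (a, b) (lshift _ k) (conj ax bx))).
- exact: (@dsum_open _ _ E F (a, b)).
- by [].
move=> y [ay b_y]; have [_ ->] := @dsum_basisP _ _ E F (a, b) y ay b_y.
by rewrite /dsum_coord (unsplitK (inl _ k)).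
Qed.

Lemma hol_vec_snd (E F : bundle X) (s : forall x, fib (dsum_bundle E F) x) x :
  hol_vec s x -> hol_vec (fun y => (s y).2) x.
Proof.
move=> hs; have [[a b] /= [ax bx]] := dsum_cover E F x.
apply: (hol_vec1 bx) => k.
apply: (holo_at_eq_near _ _ _ (hs (a, b) (rshift _ k) (conj ax bx))).
- exact: (@dsum_open _ _ E F (a, b)).
- by [].
move=> y [ay b_y]; have [_ ->] := @dsum_basisP _ _ E F (a, b) y ay b_y.
by rewrite /dsum_coord (unsplitK (inr _ k)).
Qed.

Lemma hol_vec_dual (E : bundle X) (t : forall x, 'Hom(fib E x, C^o)) x :
  (forall s, hol_vec s x -> holo_at x (fun y => t y (s y))) ->
  hol_vec (E := dual_bundle E) t x.
Proof.
move=> ht; have [a ax] := fdom_cover E x.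
apply: (@hol_vec1 (dual_bundle E) x t a ax) => k.
apply: (@holo_at_eq_near x _ (fun y => t y (tnth (frame a y) k)) (fdom a)) => //.
- exact: fdom_open.
- by move=> y ay; have [_ ->] := dual_basisP ay.
exact: ht (hol_vec_frame ax).
Qed.

Definition sub_incl (E : bundle X) (W : subbundle E) x :
  'Hom(fib (sub_bundle W) x, fib E x) := linfun (@vsval _ _ (W x)).

Lemma sub_inclE (E : bundle X) (W : subbundle E) x v :
  @sub_incl E W x v = vsval v.
Proof. by rewrite lfunE. Qed.

Lemma hol_sub_incl (E : bundle X) (W : subbundle E) x :
  hol_hom (fun y => @sub_incl E W y) x.
Proof.
have [a ax] := lf_cover W x.
apply: (@hol_hom_frame (sub_bundle W) E _ _ a ax) => l b k bx.
apply: (holo_at_eq_near (lf_open a) ax _ (lf_holo (conj ax bx))).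
by move=> y ay; rewrite sub_inclE lf_frameE.
Qed.

Lemma hol_vec_val (E : bundle X) (W : subbundle E)
    (s : forall x, subvs_of (W x)) x :
  hol_vec (E := sub_bundle W) s x -> hol_vec (fun y => vsval (s y)) x.
Proof.
move=> hs; rewrite (_ : (fun _ => _) = fun y => @sub_incl E W y (s y)).
  exact: hol_sub_incl.
by apply: functional_extensionality_dep => y; rewrite sub_inclE.
Qed.

Lemma hol_vec_sub (E : bundle X) (W : subbundle E)
    (s : forall x, subvs_of (W x)) x :
  hol_vec (fun y => vsval (s y)) x -> hol_vec (E := sub_bundle W) s x.
Proof.
rewrite (_ : (fun _ => _) = fun y => @sub_incl E W y (s y)).
  apply: hol_vec_cancel; first exact: hol_sub_incl.
  by move=> u v; rewrite !sub_inclE; exact: val_inj.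
by apply: functional_extensionality_dep => y; rewrite sub_inclE.
Qed.

Lemma dim_fib (E : bundle X) x : \dim {: fib E x} = rk E.
Proof.
have [a ax] := fdom_cover E x.
exact: size_basis (frame_basis ax).
Qed.

Lemma dim_sub_fib (E : bundle X) (W : subbundle E) x : \dim (W x) = sub_rk W.
Proof.
by rewrite -dim_sub (@dim_fib (sub_bundle W)).
Qed.

End HolomorphicSections.

(** * Degrees and subbundles *)

Section Degree.
Local Open Scope classical_set_scope.
Local Open Scope ring_scope.
Variables (R : realType) (X : riemann_surface R).
Let C := cplx R.

(** An isomorphism [E -> F] induces an isomorphism of determinant line bundles,
    and [t] is this isomorphism in the local frames. *)
Lemma det_iso (E F : bundle X) : rk E = rk F ->
  forall (f : forall x, 'Hom(fib E x, fib F x))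
         (g : forall x, 'Hom(fib F x, fib E x)),
  (forall x, cancel (f x) (g x)) -> (forall x, cancel (g x) (f x)) ->
  (forall x, hol_hom (fun y => f y) x) ->
  exists t : fidx E -> fidx F -> X -> C,
  [/\ forall a b, holo_on (fdom a `&` fdom b) (t a b),
      forall a b x, fdom a x -> fdom b x -> t a b x != 0,
      forall a a' b x, fdom a x -> fdom a' x -> fdom b x ->
        t a' b x = t a b x * \det (frame_change a a' x)
    & forall a b b' x, fdom a x -> fdom b x -> fdom b' x ->
        t a b x = \det (frame_change b b' x) * t a b' x].
Proof.
case: F => fF r I D fr oD cD bD hD /= e; subst r.
set F := Bundle oD cD bD hD => f g fK gK hf.
pose T a b x : 'M[C]_(rk E) := \matrix_(k, l)
  coord (@frame R X F b x) k (f x (tnth (@frame R X E a x) l)).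
exists (fun a b x => \det (T a b x)).
have hT a b x k l : fdom a x -> @fdom R X F b x -> holo_at x (fun y => T a b y k l).
  move=> ax bx.
  rewrite (_ : (fun _ => _) = fun y =>
    coord (@frame R X F b y) k (f y (tnth (@frame R X E a y) l))).
    exact: (hf x _ (hol_vec_frame (k := l) ax) b k bx).
  by apply/funext => y; rewrite mxE.
have TE a b x (u : 'cV_(rk E)) : fdom a x -> @fdom R X F b x -> forall k,
    (T a b x *m u) k 0 =
    coord (@frame R X F b x) k (f x (\sum_l u l 0 *: tnth (@frame R X E a x) l)).
  move=> ax bx k; rewrite !linear_sum !mxE; apply: eq_bigr => l _.
  by rewrite /= !linearZ !mxE mulrC.
split.
- by move=> a b x [ax bx]; apply: holo_at_det => k l; exact: hT.
- move=> a b x ax bx.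
  pose S : 'M[C]_(rk E) := \matrix_(k, l)
    coord (frame a x) k (g x (tnth (@frame R X F b x) l)).
  suff : \det (T a b x *m S) != 0 by rewrite det_mulmx mulf_eq0 negb_or => /andP[].
  suff -> : T a b x *m S = 1%:M by rewrite det1 oner_neq0.
  apply/matrixP => k l; rewrite mxE.
  have := TE a b x (col l S) ax bx k; rewrite mxE => TS.
  transitivity (\sum_j T a b x k j * (col l S) j 0).
    by apply: eq_bigr => j _; rewrite [col l S _ _]mxE.
  rewrite TS (eq_bigr (fun i => coord (frame a x) i (g x (tnth (@frame R X F b x) l))
     *: tnth (frame a x) i)) => [|i _]; last by rewrite !mxE.
  by rewrite -(frame_span _ ax) gK (@frame_delta _ _ F) // mxE.
- move=> a a' b x ax ax' bx; rewrite -det_mulmx; congr (\det _).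
  apply/matrixP => k l; rewrite !mxE.
  rewrite {1}(frame_span (tnth (frame a' x) l) ax) !linear_sum.
  by apply: eq_bigr => j _; rewrite /= !linearZ !mxE mulrC.
- move=> a b b' x ax bx bx'; rewrite -det_mulmx; congr (\det _).
  apply/matrixP => k l; rewrite !mxE.
  rewrite {1}(@frame_span _ _ F b' x (f x (tnth (frame a x) l)) bx') !linear_sum.
  by apply: eq_bigr => j _; rewrite /= linearZ !mxE mulrC.
Qed.

(** Transporting a meromorphic section of [det E] through [det f] multiplies it
    locally by a nowhere vanishing holomorphic function, which preserves its
    orders. *)
Lemma has_degree_iso (E F : bundle X) (f : forall x, 'Hom(fib E x, fib F x))
    (g : forall x, 'Hom(fib F x, fib E x)) d :
  rk E = rk F ->
  (forall x, cancel (f x) (g x)) -> (forall x, cancel (g x) (f x)) ->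
  (forall x, hol_hom (fun y => f y) x) ->
  has_degree E d -> has_degree F d.
Proof.
move=> e fK gK hf [s [ord [[schange smero] ofin dE]]].
have [t [th tn0 tE tF]] := det_iso e fK gK hf.
have [al alP] := boolp.choice (fdom_cover E).
(* The frame of [E] used at each point is arbitrary: by [s'E] the value does not
   depend on it. *)
pose s' b x := t (al x) b x * s (al x) x.
have s'E a b x : fdom a x -> fdom b x -> s' b x = t a b x * s a x.
  move=> ax bx; rewrite /s' (tE a (al x) b x ax (alP x) bx) -mulrA.
  by rewrite -schange.
exists s', ord; split => //; split.
  move=> b b' x bx bx'; rewrite /s' mulrA; congr (_ * _).
  exact: tF.
move=> b i p bp ip; have [a ap] := fdom_cover E p.
have [V [u [oV Vp hu un0 su]]] := smero a i p ap ip.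
exists (V `&` (fdom a `&` fdom b)), (fun x => t a b x * u x); split.
- by apply: openI => //; apply: openI; exact: fdom_open.
- by [].
- by move=> x [Vx abx]; apply: holo_atM; [exact: th abx|exact: hu].
- by move=> x [Vx [ax bx]]; rewrite mulf_neq0 ?un0 ?tn0.
- move=> x [Vx [ax _]] bx ix xp; rewrite (s'E a) // su //.
  by rewrite mulrCA.
Qed.

Lemma deg_iso (E F : bundle X) (f : forall x, 'Hom(fib E x, fib F x))
    (g : forall x, 'Hom(fib F x, fib E x)) :
  rk E = rk F ->
  (forall x, cancel (f x) (g x)) -> (forall x, cancel (g x) (f x)) ->
  (forall x, hol_hom (fun y => f y) x) ->
  deg E = deg F.
Proof.
move=> e fK gK hf; congr (xget 0 _); apply/seteqP; split => d /=.
  exact: has_degree_iso fK gK hf.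
apply: (has_degree_iso _ gK fK) => // x s hs.
apply: (hol_vec_cancel (hf x)); first exact: can_inj (fK x).
rewrite (_ : (fun y => _) = s) //.
by apply: functional_extensionality_dep => y; rewrite gK.
Qed.

Section Push.
Variables (E F : bundle X) (f : forall x, 'Hom(fib E x, fib F x)).
Hypothesis f_inj : forall x, injective (f x).
Hypothesis f_hol : forall x, hol_hom (fun y => f y) x.
Variable N : subbundle E.

Let f_ker x : lker (f x) = 0%VS.
Proof. by apply/eqP/lker0P; exact: f_inj. Qed.

Lemma push_frame p : exists (V : set X) (s : forall x, (sub_rk N).-tuple (fib F x)),
  [/\ open V, V p, forall x, V x -> basis_of (f x @: N x)%VS (s x)
    & forall k, holo_section V (fun x => tnth (s x) k)].
Proof.
have [V [s [oV Vp bs hs]]] := sub_frame N p.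
exists V, (fun x => map_tuple (f x) (s x)); split => //.
  by move=> x Vx; apply: limg_basis_of (bs x Vx); rewrite f_ker capv0.
move=> k; apply/holo_sectionP => x Vx.
rewrite (_ : (fun _ => _) = fun y => f y (tnth (s y) k)).
  by apply: f_hol; move/holo_sectionP: (hs k); exact.
by apply: functional_extensionality_dep => y; rewrite tnth_map.
Qed.

Definition push := Subbundle push_frame.

Lemma mem_push x v : (f x v \in push x) = (v \in N x).
Proof.
apply/idP/idP => [/memv_imgP[u Nu /f_inj->]//|]; exact: memv_img.
Qed.

(** The subbundles [N] and [f(N)] are isomorphic through [f]. *)
Lemma deg_push : deg (sub_bundle push) = deg (sub_bundle N).
Proof.
pose h x : 'Hom(subvs_of (N x), subvs_of (push x)) :=
  (linfun (vsproj (push x)) \o (f x \o linfun vsval))%VF.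
have hE x v : vsval (h x v) = f x (vsval v).
  by rewrite !comp_lfunE !lfunE /= vsprojK // mem_push subvsP.
have h_inj x : injective (h x).
  by move=> u v /(congr1 val) /=; rewrite !hE => /f_inj; exact: val_inj.
have hK x : cancel (h x) (h x)^-1%VF /\ cancel (h x)^-1%VF (h x).
  apply: lfun_bij; first exact: h_inj.
  by rewrite (dim_fib (sub_bundle N)) (dim_fib (sub_bundle push)).
apply/esym/(@deg_iso (sub_bundle N) (sub_bundle push) h _ erefl
  (fun x => (hK x).1) (fun x => (hK x).2)) => x s hs.
refine (@hol_vec_sub R X F push (fun y => h y (s y)) x _).
rewrite (_ : (fun _ => _) = fun y => f y (vsval (s y))).
  exact: f_hol (hol_vec_val hs).
by apply: functional_extensionality_dep => y; rewrite hE.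
Qed.

End Push.

Section ProjectorImage.
Variables (E : bundle X) (q : forall x, 'End(fib E x)) (r : nat).
Hypothesis q_hol : forall x, hol_hom (fun y => q y) x.
Hypothesis q_idem : forall x u, q x (q x u) = q x u.
Hypothesis q_dim : forall x, \dim (limg (q x)) = r.

(** Linear independence is the nonvanishing of a minor, an open condition. *)
Lemma free_near (a : fidx E) (t : forall x, r.-tuple (fib E x)) p :
  (forall k, holo_section (fdom a) (fun x => tnth (t x) k)) ->
  fdom a p -> free (t p) ->
  exists V : set X, [/\ open V, V p, V `<=` fdom a & forall x, V x -> free (t x)].
Proof.
move=> ht ap tfree.
pose A y : 'M[C]_(r, rk E) := \matrix_(i, j) coord (frame a y) j (tnth (t y) i).
have uA y (u : 'rV_r) j : (u *m A y) 0 j =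
    coord (frame a y) j (\sum_i u 0 i *: tnth (t y) i).
  by rewrite linear_sum !mxE; apply: eq_bigr => i _; rewrite !mxE linearZ.
have hA x i j : fdom a x -> holo_at x (fun y => A y i j).
  move=> ax; rewrite (_ : (fun _ => _) = fun y => coord (frame a y) j (tnth (t y) i)).
    exact: ht.
  by apply/funext => y; rewrite mxE.
have Afree : row_free (A p).
  rewrite -kermx_eq0; apply/rowV0P => u /sub_kermxP u0.
  have s0 : \sum_i u 0 i *: (t p)`_i = 0.
    rewrite (frame_span (\sum_i _) ap) big1 // => j _.
    rewrite (_ : coord _ _ _ = (u *m A p) 0 j); first by rewrite u0 mxE scale0r.
    by rewrite uA; congr (coord _ _ _); apply: eq_bigr => i _; rewrite (tnth_nth 0).
  by have /freeP fa := tfree; apply/rowP => i; rewrite mxE (fa _ s0).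
pose P := pinvmx (A p); pose D y := A y *m P.
have Dp : D p = 1%:M by rewrite /D mulmxVp.
have hD x : fdom a x -> holo_at x (fun y => \det (D y)).
  move=> ax; apply: holo_at_det; apply: holo_at_mulmx => i j; first exact: hA.
  exact: holo_at_cst.
exists (fdom a `&` [set y | \det (D y) != 0]); split.
- by apply: open_holo_neq0 => //; exact: fdom_open.
- by split=> //=; rewrite Dp det1 oner_neq0.
- by move=> x [].
move=> x [ax /= Dx]; apply/freeP => c c0 i.
pose u : 'rV[C]_r := \row_i c i.
have u0 : u *m A x = 0.
  apply/rowP => j; rewrite uA mxE.
  rewrite (_ : \sum_i _ = 0) ?linear0 // -[RHS]c0.
  by apply: eq_bigr => k _; rewrite mxE (tnth_nth 0).
have : u *m D x = 0 by rewrite mulmxA u0 mul0mx.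
move/(congr1 (mulmx^~ (\adj (D x)))); rewrite -mulmxA mul_mx_adj mul0mx mul_mx_scalar.
move/eqP; rewrite scaler_eq0 (negbTE Dx) /= => /eqP/rowP/(_ i).
by rewrite !mxE.
Qed.

(** A basis of the image of [q] at [p], extended to a neighbourhood with
    constant coordinates and projected by [q], stays free near [p]; as the
    rank is constant, it stays a basis of the image. *)
Lemma proj_image_frame p : exists (V : set X) (s : forall x, r.-tuple (fib E x)),
  [/\ open V, V p, forall x, V x -> basis_of (limg (q x)) (s x)
    & forall k, holo_section V (fun x => tnth (s x) k)].
Proof.
have [a ap] := fdom_cover E p.
have sz : size (vbasis (limg (q p))) == r by rewrite size_tuple q_dim.
pose m : r.-tuple (fib E p) := Tuple sz.
pose v y l := \sum_k coord (frame a p) k (tnth m l) *: tnth (@frame R X E a y) k.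
pose t y := [tuple q y (v y l) | l < r].
have ht k : holo_section (fdom a) (fun x => tnth (t x) k).
  apply/holo_sectionP => x ax.
  rewrite (_ : (fun _ => _) = fun y => q y (v y k)).
    apply: q_hol; apply: hol_vec_sum => j.
    by apply: hol_vecZ; [exact: holo_at_cst|exact: hol_vec_frame].
  by apply: functional_extensionality_dep => y; rewrite tnth_mktuple.
have tp : t p = m.
  apply: eq_from_tnth => l; rewrite tnth_mktuple /v -frame_span //.
  have : tnth m l \in limg (q p) by apply: vbasis_mem; rewrite mem_tnth.
  by move/memv_imgP => [u _ ->]; rewrite q_idem.
have tfree : free (t p) by rewrite tp; exact: basis_free (vbasisP _).
have [V [oV Vp Va Vfree]] := free_near ht ap tfree.
exists V, t; split => //.
  move=> x Vx; rewrite basisEfree Vfree // q_dim size_tuple leqnn andbT.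
  apply/span_subvP => w /tnthP[l ->]; rewrite tnth_mktuple.
  exact: memv_img (memvf _).
move=> k; apply/holo_sectionP => x Vx.
by move/holo_sectionP: (ht k); apply; exact: Va.
Qed.

Definition proj_image := Subbundle proj_image_frame.

Lemma mem_proj_image x u : (u \in proj_image x) = (q x u == u).
Proof.
apply/idP/eqP => [/memv_imgP[w _ ->]|<-]; first exact: q_idem.
exact: memv_img (memvf _).
Qed.

End ProjectorImage.

End Degree.

(** * Symplectic bundles *)

Section Symplectic.
Local Open Scope ring_scope.
Local Open Scope classical_set_scope.
Variables (R : realType) (X : riemann_surface R).
Let C := cplx R.

Section Form.
Variables (E : bundle X) (Om : symplectic_form E).
Local Notation om := (sform Om).

Lemma sformDl x (u v w : fib E x) : om (u + v) w = om u w + om v w.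
Proof. by have := sform_linl Om w 1 u v; rewrite scale1r mul1r. Qed.

Lemma sformDr x (u v w : fib E x) : om w (u + v) = om w u + om w v.
Proof. by have := sform_linr Om w 1 u v; rewrite scale1r mul1r. Qed.

Lemma sformZl x c (u v : fib E x) : om (c *: u) v = c * om u v.
Proof. by have := sform_linl Om v c u 0; rewrite sform0l !addr0. Qed.

Lemma sformZr x c (u v : fib E x) : om u (c *: v) = c * om u v.
Proof. by have := sform_linr Om u c v 0; rewrite sform0r !addr0. Qed.

Lemma sformBl x (u v w : fib E x) : om (u - v) w = om u w - om v w.
Proof. by rewrite -scaleN1r sformDl sformZl mulN1r. Qed.

Lemma sformBr x (u v w : fib E x) : om w (u - v) = om w u - om w v.
Proof. by rewrite -scaleN1r sformDr sformZr mulN1r. Qed.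

Lemma sform_skew x (u v : fib E x) : om u v = - om v u.
Proof.
apply/eqP; rewrite -addr_eq0; apply/eqP.
have := sform_alt Om (u + v).
by rewrite sformDl !sformDr !sform_alt add0r addr0.
Qed.

Lemma sform_nondegr x (v : fib E x) : (forall u, om u v = 0) -> v = 0.
Proof.
by move=> v0; apply: (@sform_nondeg _ _ _ Om) => u; rewrite sform_skew v0 oppr0.
Qed.

Lemma sform_inj x (v w : fib E x) : (forall u, om u v = om u w) -> v = w.
Proof.
move=> vw; apply/eqP; rewrite -subr_eq0; apply/eqP/sform_nondegr => u.
by rewrite sformBr vw subrr.
Qed.

Lemma sform_suml x n (s : 'I_n -> fib E x) w :
  om (\sum_i s i) w = \sum_i om (s i) w.
Proof.
exact: (big_morph (fun u => om u w) (fun u v => sformDl u v w) (sform0l Om w)).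
Qed.

Lemma sform_sumr x n (s : 'I_n -> fib E x) w :
  om w (\sum_i s i) = \sum_i om w (s i).
Proof.
exact: (big_morph (om w) (fun u v => sformDr u v w) (sform0r Om w)).
Qed.

Lemma holo_sform x (s t : forall x, fib E x) : hol_vec s x -> hol_vec t x ->
  holo_at x (fun y => om (s y) (t y)).
Proof.
move=> hs ht; have [a ax] := fdom_cover E x.
refine (@holo_at_eq_near R X x _ (fun y => \sum_k \sum_l
  (coord (frame a y) k (s y) * coord (frame a y) l (t y)) *
  om (tnth (frame a y) k) (tnth (frame a y) l)) (fdom a) _ ax _ _).
- exact: fdom_open.
- move=> y ay; rewrite {1}(frame_span (s y) ay) sform_suml.
  apply: eq_bigr => k _; rewrite {1}(frame_span (t y) ay) sform_sumr.
  apply: eq_bigr => l _; rewrite sformZl sformZr mulrA //.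
apply: holo_at_sum => k _; apply: holo_at_sum => l _.
apply: holo_atM; last exact: sform_holo.
by apply: holo_atM; [exact: hs|exact: ht].
Qed.

(** The isomorphism [v |-> Omega(., v)] of a symplectic bundle with its dual; the
    form is taken on the right so that [w |-> (p w, flat w)] carries the form to
    the pairing [t(v) - s(w)] with the right sign. *)
Section Flat.
Variable x : X.

Section FlatVector.
Variable v : fib E x.
Definition flat_fun (u : fib E x) : C^o := om u v.
Lemma flat_fun_linear : linear flat_fun.
Proof. by move=> c u w; rewrite /flat_fun (sform_linl Om). Qed.
HB.instance Definition _ :=
  GRing.isLinear.Build C _ _ _ flat_fun flat_fun_linear.
End FlatVector.

Definition flat_map v : 'Hom(fib E x, C^o) := linfun (flat_fun v).
Lemma flat_map_linear : linear flat_map.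
Proof.
move=> c u w; apply/lfunP => v.
by rewrite add_lfunE scale_lfunE !lfunE /= /flat_fun (sform_linr Om).
Qed.
HB.instance Definition _ :=
  GRing.isLinear.Build C _ _ _ flat_map flat_map_linear.
Definition flat : 'Hom(fib E x, 'Hom(fib E x, C^o)) := linfun flat_map.

Lemma flatE v u : flat v u = om u v.
Proof. by rewrite lfunE /= lfunE. Qed.

Lemma flat_inj : injective flat.
Proof. by move=> v w vw; apply: sform_inj => u; rewrite -!flatE vw. Qed.

Lemma flatK : cancel flat flat^-1%VF /\ cancel flat^-1%VF flat.
Proof. by apply: lfun_bij; [exact: flat_inj|rewrite dim_dual]. Qed.

End Flat.

(** [flat] is injective, so a section [s] is holomorphic as soon as the section
    [Omega(., s)] of the dual bundle is. *)
Lemma hol_vec_flat (s : forall x, fib E x) x :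
  (forall t, hol_vec t x -> holo_at x (fun y => om (t y) (s y))) -> hol_vec s x.
Proof.
move=> hs; apply: (@hol_vec_cancel R X E (dual_bundle E) flat).
- move=> t ht; apply: hol_vec_dual => w hw.
  rewrite (_ : (fun _ => _) = fun y => om (w y) (t y)); first exact: holo_sform.
  by apply/funext => y; rewrite flatE.
- exact: flat_inj.
- apply: hol_vec_dual => w hw.
  rewrite (_ : (fun _ => _) = fun y => om (w y) (s y)); first exact: hs.
  by apply/funext => y; rewrite flatE.
Qed.

Definition adjoint (p : forall x, 'End(fib E x)) x : 'End(fib E x) :=
  ((flat x)^-1 \o (precomp (p x) \o flat x))%VF.

Lemma adjointE (p : forall x, 'End(fib E x)) x u v : om u (adjoint p x v) = om (p x u) v.
Proof.
rewrite -flatE comp_lfunE (flatK x).2 comp_lfunE precompE flatE //.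
Qed.

Lemma hol_adjoint (p : forall x, 'End(fib E x)) x : hol_hom (fun y => p y) x ->
  hol_hom (fun y => adjoint p y) x.
Proof.
move=> hp s hs; apply: hol_vec_flat => t ht.
rewrite (_ : (fun _ => _) = fun y => om (p y (t y)) (s y)).
  exact: holo_sform (hp _ ht) hs.
by apply/funext => y; rewrite adjointE.
Qed.

(** Restricting [Omega(., v)] to the image of [f] defines a map of [v] with the
    kernel of [g], because [Omega(f u, v) = Omega(u, g v)]: the image of [g] embeds
    in the dual of the image of [f]. *)
Lemma dim_limg_adj_le x (f g : 'End(fib E x)) :
  (forall u v, om (f u) v = om u (g v)) -> (\dim (limg g) <= \dim (limg f))%N.
Proof.
move=> fg; pose U := limg f.
pose th : 'Hom(fib E x, 'Hom(subvs_of U, C^o)) :=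
  (precomp (linfun (@vsval _ _ U)) \o flat x)%VF.
have thE v u : th v u = om (vsval u) v.
  by rewrite comp_lfunE precompE flatE lfunE.
have kth : lker th = lker g.
  apply/vspaceP => v; rewrite !memv_ker; apply/eqP/eqP => v0.
    apply: (@sform_nondegr x) => u; rewrite -fg.
    have -> : f u = vsval (vsproj U (f u)) by rewrite vsprojK // memv_img ?memvf.
    by rewrite -thE v0 zero_lfunE.
  apply/lfunP => u; rewrite thE zero_lfunE.
  by have /memv_imgP[w _ ->] := subvsP u; rewrite fg v0 sform0r.
have := limg_ker_dim th fullv; rewrite kth -(limg_ker_dim g fullv).
move/addnI <-; apply: leq_trans (dimvS (subvf _)) _.
by rewrite dim_dual dim_sub.
Qed.

Lemma dim_limg_adj x (f g : 'End(fib E x)) :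
  (forall u v, om (f u) v = om u (g v)) -> \dim (limg g) = \dim (limg f).
Proof.
move=> fg; apply/eqP; rewrite eqn_leq !dim_limg_adj_le // => u v.
by rewrite sform_skew -fg -sform_skew.
Qed.

End Form.

Section Restriction.
Variables (E : bundle X) (M : subbundle E).

Section RestrictForm.
Variable Om : symplectic_form E.
Hypothesis M_nondeg : forall x u, u \in M x ->
  (forall v, v \in M x -> sform Om u v = 0) -> u = 0.

Definition res_form_fun x (u v : subvs_of (M x)) : C :=
  sform Om (vsval u) (vsval v).

Lemma res_form_linl x v : scalar (fun u => @res_form_fun x u v).
Proof. by move=> c u w; rewrite /res_form_fun linearP (sform_linl Om). Qed.

Lemma res_form_linr x u : scalar (@res_form_fun x u).
Proof. by move=> c v w; rewrite /res_form_fun linearP (sform_linr Om). Qed.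

Lemma res_form_alt x u : @res_form_fun x u u = 0.
Proof. exact: sform_alt. Qed.

Lemma res_form_nondeg x u : (forall v, @res_form_fun x u v = 0) -> u = 0.
Proof.
move=> u0; apply: val_inj; apply: (M_nondeg (subvsP u)) => v Mv.
by have := u0 (vsproj (M x) v); rewrite /res_form_fun vsprojK.
Qed.

Lemma res_form_holo (a : fidx (sub_bundle M)) k l : holo_on (fdom a)
  (fun x => res_form_fun (tnth (frame a x) k) (tnth (frame a x) l)).
Proof.
move=> x ax; apply: holo_sform.
  exact: (hol_vec_val (@hol_vec_frame _ _ (sub_bundle M) x a k ax)).
exact: (hol_vec_val (@hol_vec_frame _ _ (sub_bundle M) x a l ax)).
Qed.

Definition res_form : symplectic_form (sub_bundle M) :=
  @SymplecticForm R X (sub_bundle M) _ res_form_linl res_form_linr res_form_alt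
    res_form_nondeg res_form_holo.
End RestrictForm.

Section RestrictField.
Variable phi : higgs_field E.
Hypothesis M_inv : hf_invariant phi M.

Definition res_hf i x : 'End(subvs_of (M x)) :=
  (linfun (vsproj (M x)) \o (phi i x \o linfun (@vsval _ _ (M x))))%VF.

Lemma res_hfE i x u : cdom i x -> vsval (res_hf i x u) = phi i x (vsval u).
Proof.
move=> ix; rewrite !comp_lfunE !lfunE /= vsprojK //.
by apply: M_inv => //; exact: subvsP.
Qed.

Lemma hol_hf i x : cdom i x -> hol_hom (fun y => phi i y) x.
Proof.
move=> ix; have [a ax] := fdom_cover E x.
apply: (hol_hom_frame ax) => l; apply: (hol_vec1 ax) => k.
exact: hf_holo (conj ix ax).
Qed.

Lemma res_hf_holo i (a : fidx (sub_bundle M)) k l : holo_on (cdom i `&` fdom a)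
  (fun x => coord (frame a x) k (res_hf i x (tnth (frame a x) l))).
Proof.
move=> x [ix ax].
refine (@hol_vec_sub R X E M (fun y => res_hf i y (tnth (frame a y) l)) x _ a k ax).
have h := hol_hf ix (hol_vec_val (@hol_vec_frame _ _ (sub_bundle M) x a l ax)).
apply: (@hol_vec_near _ _ _ x _ _ (cdom i) (cdom_open i) ix _ h) => y iy.
exact: res_hfE.
Qed.

Lemma res_hf_compat i j x : cdom i x -> cdom j x ->
  res_hf i x = dchart i j x *: res_hf j x.
Proof.
move=> ix jx; apply/lfunP => u; apply: val_inj; rewrite scale_lfunE linearZ /=.
by rewrite !res_hfE // (hf_compat phi ix jx) scale_lfunE.
Qed.

Definition res_field : higgs_field (sub_bundle M) :=
  @HiggsField R X (sub_bundle M) res_hf res_hf_holo res_hf_compat.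

End RestrictField.
End Restriction.
End Symplectic.

(** * Splitting off an isotropic subbundle *)

Section Splittings.
Local Open Scope classical_set_scope.
Local Open Scope ring_scope.
Variables (R : realType) (X : riemann_surface R).
Let C := cplx R.

(** [p] is a projector onto [N] and [p'] is its adjoint. The image of [p'] is the
    orthogonal of the kernel of [p], so [split_perp] says that this kernel is
    coisotropic. *)
Record isotropic_splitting (E : bundle X) (Om : symplectic_form E)
    (phi : higgs_field E) (N : subbundle E) (p p' : forall x, 'End(fib E x)) :
    Prop := IsotropicSplitting {
  split_hol : forall x, hol_hom (fun y => p y) x;
  split_hol' : forall x, hol_hom (fun y => p' y) x;
  split_adj : forall x u v, sform Om (p x u) v = sform Om u (p' x v);
  split_comm : forall i x u, cdom i x -> phi i x (p x u) = p x (phi i x u);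
  split_mem : forall x u, p x u \in N x;
  split_id : forall x u, u \in N x -> p x u = u;
  split_perp : forall x u, p x (p' x u) = 0 }.

Section FromComplement.
Variables (E : bundle X) (W W' : subbundle E).
Hypothesis WW' : complementary W W'.

(** The projection is the first component of the inverse of the sum map
    [W (+) W' -> E]. *)
Lemma hol_complement_proj x : hol_hom (fun y => daddv_pi (W y) (W' y)) x.
Proof.
move=> s hs; pose D := dsum_bundle (sub_bundle W) (sub_bundle W').
pose S y : 'Hom(fib D y, fib E y) :=
  ((linfun (@vsval _ _ (W y)) \o linfun fst)
   + (linfun (@vsval _ _ (W' y)) \o linfun snd))%VF.
have SE y w : S y w = vsval w.1 + vsval w.2.
  by rewrite add_lfunE !comp_lfunE !lfunE.
pose a y := vsproj (W y) (daddv_pi (W y) (W' y) (s y)).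
pose b y := vsproj (W' y) (daddv_pi (W' y) (W y) (s y)).
have hab : hol_vec (E := D) (fun y => (a y, b y)) x.
  apply: (@hol_vec_cancel R X D E S).
  - move=> t ht; rewrite (_ : (fun _ => _) = fun y => vsval (t y).1 + vsval (t y).2).
      apply: hol_vecD; apply: hol_vec_val; [exact: hol_vec_fst ht|exact: hol_vec_snd ht].
    by apply: functional_extensionality_dep => y; rewrite SE.
  - move=> [u u'] [v v']; rewrite !SE /= => /eqP.
    rewrite -subr_eq0 opprD addrACA addr_eq0 => /eqP uv.
    have [_ cap0] := WW' x.
    have : vsval u - vsval v \in (W x :&: W' x)%VS.
      by rewrite memv_cap memvB ?subvsP //= uv memvN memvB ?subvsP.
    rewrite cap0 memv0 => /eqP uv0.
    move: uv; rewrite uv0 => /eqP; rewrite eq_sym oppr_eq0 subr_eq0 => /eqP uv'.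
    by move/eqP: uv0; rewrite subr_eq0 => /eqP uv0; congr pair; exact: val_inj.
  - rewrite (_ : (fun _ => _) = s) //; apply: functional_extensionality_dep => y.
    have [sum1 cap0] := WW' y.
    by rewrite SE !vsprojK ?memv_pi // daddv_pi_add ?sum1 ?memvf.
have := hol_vec_val (hol_vec_fst hab).
rewrite (_ : (fun _ => _) = fun y => daddv_pi (W y) (W' y) (s y)) //.
by apply: functional_extensionality_dep => y; rewrite vsprojK // memv_pi.
Qed.

Lemma complement_projE x u v : u \in W x -> v \in W' x ->
  daddv_pi (W x) (W' x) (u + v) = u.
Proof.
move=> Wu Wv; have [_ cap0] := WW' x; rewrite linearD /= (daddv_pi_id cap0 Wu).
have cap0' : (W' x :&: W x = 0)%VS by rewrite capvC.
have : daddv_pi (W x) (W' x) v + daddv_pi (W' x) (W x) v = v.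
  by apply: daddv_pi_add => //; rewrite memvE (subv_trans _ (addvSr _ _)).
rewrite (daddv_pi_id cap0' Wv) => /eqP; rewrite addrC -subr_eq0 addrAC subrr add0r.
by move/eqP=> ->; rewrite addr0.
Qed.

Lemma complement_decomp x w : exists u v, [/\ u \in W x, v \in W' x & w = u + v].
Proof.
have [sum1 _] := WW' x; have : w \in (W x + W' x)%VS by rewrite sum1 memvf.
by move/memv_addP => [u Wu [v Wv ->]]; exists u, v.
Qed.

Lemma complement_splitting (Om : symplectic_form E) (phi : higgs_field E) :
  hf_invariant phi W -> hf_invariant phi W' -> coisotropic Om W' ->
  exists p p', isotropic_splitting Om phi W p p'.
Proof.
move=> iW iW' coW'; pose p x := daddv_pi (W x) (W' x).
exists p, (adjoint Om p); split.
- exact: hol_complement_proj.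
- by move=> x; apply: hol_adjoint; exact: hol_complement_proj.
- by move=> x u v; rewrite adjointE.
- move=> i x w ix; have [u [v [Wu Wv ->]]] := complement_decomp w.
  by rewrite /p (linearD (phi i x)) /= !complement_projE //; [exact: iW|exact: iW'].
- by move=> x u; exact: memv_pi.
- by move=> x u Wu; have := complement_projE Wu (mem0v (W' x)); rewrite addr0.
- move=> x w; have perp : sub_perp Om W' (adjoint Om p x w).
    move=> u Wu; rewrite adjointE -[u]add0r /p complement_projE ?mem0v //.
    by rewrite sform0l.
  have {}perp : adjoint Om p x w \in W' x by exact: coW' perp.
  by rewrite -[adjoint _ _ _ _]add0r /p complement_projE // mem0v.
Qed.

End FromComplement.

Section SplitOff.
Variables (n : nat) (H : ustar_higgs X n).
Local Notation E := (us_bundle H).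
Local Notation om := (sform (us_form H)).
Local Notation phi := (us_field H).
Variables (N : subbundle E) (p p' : forall x, 'End(fib E x)).
Hypothesis N_iso : isotropic (us_form H) N.
Hypothesis N_inv : hf_invariant phi N.
Hypothesis Np : isotropic_splitting (us_form H) phi N p p'.

Lemma split_adj' x u v : om (p' x u) v = om u (p x v).
Proof. by rewrite sform_skew -(split_adj Np) -sform_skew. Qed.

Lemma split_idem x u : p x (p x u) = p x u.
Proof. by rewrite (split_id Np) //; exact: (split_mem Np). Qed.

Lemma split_idem' x u : p' x (p' x u) = p' x u.
Proof.
by apply: (sform_inj (Om := us_form H)) => w; rewrite -!(split_adj Np) split_idem.
Qed.

Lemma split_isotropic x u : p' x (p x u) = 0.
Proof.
apply: (sform_inj (Om := us_form H)) => w; rewrite -(split_adj Np) sform0r.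
exact: (N_iso (split_mem Np u) (split_mem Np w)).
Qed.

Lemma split_comm' i x u : cdom i x -> phi i x (p' x u) = p' x (phi i x u).
Proof.
move=> ix; apply: (sform_inj (Om := us_form H)) => w.
rewrite -us_sym // -!(split_adj Np) -us_sym //.
by rewrite (split_comm Np).
Qed.

(** The orthogonal projector onto the orthogonal of [N (+) im p']. *)
Definition coproj x : 'End(fib E x) := (\1 - p x - p' x)%VF.

Lemma coprojE x u : coproj x u = u - p x u - p' x u.
Proof. by rewrite !add_lfunE !opp_lfunE id_lfunE. Qed.

Lemma hol_coproj x : hol_hom (fun y => coproj y) x.
Proof.
move=> s hs; rewrite (_ : (fun _ => _) = fun y => s y - p y (s y) - p' y (s y)).
  apply: hol_vecB; last exact: (split_hol' Np hs).
  exact: hol_vecB hs (split_hol Np hs).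
by apply: functional_extensionality_dep => y; rewrite coprojE.
Qed.

Lemma split_coproj x u : p x (coproj x u) = 0.
Proof. by rewrite coprojE !linearB /= split_idem (split_perp Np) subr0 subrr. Qed.

Lemma split_coproj' x u : p' x (coproj x u) = 0.
Proof.
by rewrite coprojE !linearB /= split_idem' split_isotropic subr0 subrr.
Qed.

Lemma coproj_idem x u : coproj x (coproj x u) = coproj x u.
Proof. by rewrite {1}coprojE split_coproj split_coproj' !subr0. Qed.

Lemma coproj_adj x u v : om (coproj x u) v = om u (coproj x v).
Proof. by rewrite !coprojE !sformBl !sformBr (split_adj Np) split_adj' addrAC. Qed.

Lemma coproj_comm i x u : cdom i x ->
  phi i x (coproj x u) = coproj x (phi i x u).
Proof.
by move=> ix; rewrite !coprojE !linearB /= (split_comm Np) // split_comm'.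
Qed.

Lemma limg_split x : limg (p x) = N x.
Proof.
apply/vspaceP => u; apply/memv_imgP/idP => [[w _ ->]|Nu].
  exact: (split_mem Np).
by exists u; rewrite ?memvf // (split_id Np).
Qed.

(** The kernel is the direct sum of the images of [p] and [p'], which have the
    same dimension because [p] and [p'] are adjoint. *)
Lemma dim_lker_coproj x : \dim (lker (coproj x)) = (sub_rk N).*2.
Proof.
have -> : lker (coproj x) = (limg (p x) + limg (p' x))%VS.
  apply/vspaceP => u; rewrite memv_ker coprojE; apply/eqP/memv_addP.
    move=> u0; exists (p x u); first exact: memv_img (memvf _).
    exists (p' x u); first exact: memv_img (memvf _).
    by apply/eqP; rewrite -subr_eq0 opprD addrA u0.
  move=> [_ /memv_imgP[v _ ->] [_ /memv_imgP[w _ ->] ->]].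
  have -> : p x (p x v + p' x w) = p x v.
    by rewrite linearD /= split_idem (split_perp Np) addr0.
  have -> : p' x (p x v + p' x w) = p' x w.
    by rewrite linearD /= split_idem' split_isotropic add0r.
  by rewrite addrAC addrK subrr.
rewrite dimv_disjoint_sum.
  rewrite (dim_limg_adj (fun u v => split_adj Np u v)) addnn limg_split.
  by rewrite dim_sub_fib.
apply/eqP; rewrite -subv0; apply/subvP => u; rewrite memv_cap memv0.
case/andP => /memv_imgP[v _ ->] /memv_imgP[w _ vw].
by rewrite -split_idem vw (split_perp Np).
Qed.

Lemma dim_limg_coproj x : \dim (limg (coproj x)) = (n - sub_rk N).*2.
Proof.
have := limg_ker_dim (coproj x) fullv.
rewrite capfv dim_lker_coproj dim_fib sp_rk doubleB => <-.
by rewrite addKn.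
Qed.

Lemma split_rk : (sub_rk N <= n)%N.
Proof.
have [x _] := rs_nonempty X.
have := limg_ker_dim (coproj x) fullv.
rewrite capfv dim_lker_coproj dim_fib sp_rk -leq_double => <-.
exact: leq_addr.
Qed.

Definition orth := proj_image hol_coproj coproj_idem dim_limg_coproj.

Lemma mem_orth x u : (u \in orth x) = (coproj x u == u).
Proof. exact: mem_proj_image. Qed.

Lemma coproj_mem x u : coproj x u \in orth x.
Proof. by rewrite mem_orth coproj_idem. Qed.

Lemma orth_nondeg x u : u \in orth x ->
  (forall v, v \in orth x -> om u v = 0) -> u = 0.
Proof.
rewrite mem_orth => /eqP qu u0; apply: (@sform_nondeg _ _ _ (us_form H)) => v.
by rewrite -qu coproj_adj u0 // coproj_mem.
Qed.

Lemma orth_inv : hf_invariant phi orth.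
Proof.
by move=> i x u ix; rewrite !mem_orth -coproj_comm // => /eqP->.
Qed.

Lemma orth_sym i x (u v : fib (sub_bundle orth) x) : cdom i x ->
  sform (res_form orth_nondeg) (res_field orth_inv i x u) v =
  sform (res_form orth_nondeg) u (res_field orth_inv i x v).
Proof.
by move=> ix; rewrite /= /res_form_fun !(res_hfE orth_inv) // us_sym.
Qed.

Definition orth_higgs : ustar_higgs X (n - sub_rk N) :=
  @UstarHiggs R X (n - sub_rk N)
    (@SymplecticBundle R X (n - sub_rk N) (sub_bundle orth) erefl
       (res_form orth_nondeg)) (res_field orth_inv) orth_sym.

Definition sub_higgs : gl_higgs X (sub_rk N) :=
  @GLHiggs R X (sub_rk N) (sub_bundle N) erefl (res_field N_inv).

Definition split_map x : 'Hom(fib E x,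
    fib (us_bundle (us_sum (us_of_gl sub_higgs) orth_higgs)) x) :=
  lpair (lpair (linfun (vsproj (N x)) \o p x)%VF
               (precomp (sub_incl N x) \o flat (us_form H) x)%VF)
        (linfun (vsproj (orth x)) \o coproj x)%VF.

Lemma split_mapE x u : split_map x u =
  ((vsproj (N x) (p x u), precomp (sub_incl N x) (flat (us_form H) x u)),
   vsproj (orth x) (coproj x u)).
Proof. by rewrite !lpairE !comp_lfunE !lfunE. Qed.

Lemma vsval_proj_split x u : vsval (vsproj (N x) (p x u)) = p x u.
Proof. by rewrite vsprojK //; exact: (split_mem Np u). Qed.

Lemma vsval_proj_orth x u : vsval (vsproj (orth x) (coproj x u)) = coproj x u.
Proof. by rewrite vsprojK // coproj_mem. Qed.

Lemma hol_split_map x : hol_hom (fun y => split_map y) x.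
Proof.
move=> s hs; rewrite (_ : (fun _ => _) = fun y =>
  ((vsproj (N y) (p y (s y)), precomp (sub_incl N y) (flat (us_form H) y (s y))),
   vsproj (orth y) (coproj y (s y)))); last first.
  by apply: functional_extensionality_dep => y; rewrite split_mapE.
apply: (@hol_vec_pair _ _ (dsum_bundle (sub_bundle N) (dual_bundle (sub_bundle N)))
  (sub_bundle orth)).
  apply: (@hol_vec_pair _ _ (sub_bundle N) (dual_bundle (sub_bundle N))).
    apply: hol_vec_sub; rewrite (_ : (fun _ => _) = fun y => p y (s y)).
      exact: (split_hol Np hs).
    by apply: functional_extensionality_dep => y; rewrite vsval_proj_split.
  apply: (@hol_vec_dual _ _ (sub_bundle N)) => t ht.
  rewrite (_ : (fun _ => _) = fun y => om (vsval (t y)) (s y)).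
    exact: holo_sform (hol_vec_val ht) hs.
  by apply/funext => y; rewrite precompE flatE sub_inclE.
apply: hol_vec_sub; rewrite (_ : (fun _ => _) = fun y => coproj y (s y)).
  exact: hol_coproj.
by apply: functional_extensionality_dep => y; rewrite vsval_proj_orth.
Qed.

(** If [p u], [q u] and the restriction of [Omega(., u)] to [N] vanish, then so
    does [p' u], and [u = p u + p' u + q u]. Bijectivity follows by counting
    dimensions. *)
Lemma split_map_inj x : injective (split_map x).
Proof.
apply/lker0P; rewrite -subv0; apply/subvP => u; rewrite memv_ker memv0 split_mapE.
move=> /eqP[pu0 tu0 qu0].
have pu : p x u = 0 by rewrite -vsval_proj_split pu0 linear0.
have qu : coproj x u = 0 by rewrite -vsval_proj_orth qu0 linear0.
have p'u : p' x u = 0.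
  apply: (sform_nondegr (Om := us_form H)) => w.
  rewrite -(split_adj Np) -vsval_proj_split -sub_inclE -flatE -precompE tu0.
  by rewrite zero_lfunE.
by move: qu; rewrite coprojE pu p'u !subr0 => ->.
Qed.

Lemma us_iso_split : us_iso H (us_sum (us_of_gl sub_higgs) orth_higgs).
Proof.
exists split_map; split.
- move=> x; have [] := @lfun_bij _ _ _ (split_map x) (@split_map_inj x).
    by rewrite !dim_fib !sp_rk subnKC // split_rk.
  by move=> fK Kf; exists (split_map x)^-1%VF.
- move=> a b k l x [ax bx].
  exact: ((hol_homP split_map x).2 (hol_split_map (x := x)) a b k l ax bx).
- move=> x u v; rewrite !split_mapE /= /sum_form_fun /= /std_form_fun /res_form_fun /=.
  rewrite vsval_proj_orth vsval_proj_orth !precompE !flatE !sub_inclE.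
  rewrite !vsval_proj_split coproj_adj coproj_idem coprojE !sformBr.
  rewrite (sform_skew _ (p x v) u) (split_adj Np); ring.
- move=> i x u ix; rewrite !split_mapE /= /sum_hf pair_lfunE /= /sum_hf pair_lfunE /=.
  congr (_, _, _).
  + apply: val_inj; rewrite /= (res_hfE N_inv) // !vsval_proj_split.
    by rewrite (split_comm Np).
  + apply/lfunP => v; rewrite /tr_hf tr_lfunE !precompE !flatE !sub_inclE.
    by rewrite (res_hfE N_inv) // us_sym.
  + apply: val_inj; rewrite /= (res_hfE orth_inv) // !vsval_proj_orth.
    by rewrite coproj_comm.
Qed.

End SplitOff.
End Splittings.

(** * Stability of the two pieces *)

Section SubSub.
Local Open Scope classical_set_scope.
Local Open Scope ring_scope.
Variables (R : realType) (X : riemann_surface R).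
Let C := cplx R.
Variables (E : bundle X) (M : subbundle E).

Lemma sub_incl_inj x : injective (sub_incl M x).
Proof. by move=> u v; rewrite !sub_inclE; exact: val_inj. Qed.

(** A subbundle of a subbundle of [E], seen in [E]. *)
Definition push_sub (N : subbundle (sub_bundle M)) : subbundle E :=
  push sub_incl_inj (hol_sub_incl (W := M)) N.

Variable N : subbundle (sub_bundle M).

Lemma mem_push_sub x v : (vsval v \in push_sub N x) = (v \in N x).
Proof. by rewrite -sub_inclE mem_push. Qed.

Lemma push_subP x u : reflect (exists2 v, v \in N x & u = vsval v) (u \in push_sub N x).
Proof.
apply: (iffP memv_imgP) => -[v Nv ->]; exists v => //.
  exact: sub_inclE.
by rewrite sub_inclE.
Qed.

Lemma deg_push_sub : deg (sub_bundle (push_sub N)) = deg (sub_bundle N).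
Proof. exact: deg_push. Qed.

Lemma push_sub_inv (phi : higgs_field E) (M_inv : hf_invariant phi M) :
  hf_invariant (res_field M_inv) N -> hf_invariant phi (push_sub N).
Proof.
move=> N_inv i x u ix /push_subP[v Nv ->].
rewrite -(res_hfE M_inv) // mem_push_sub; exact: N_inv.
Qed.

Lemma push_sub_isotropic (Om : symplectic_form E) M_nondeg :
  isotropic (@res_form _ _ _ M Om M_nondeg) N -> isotropic Om (push_sub N).
Proof.
move=> N_iso x u /push_subP[v Nv ->] w /push_subP[z Nz ->].
exact: (N_iso x v Nv z Nz).
Qed.

Lemma push_sub_isotropic_sub (Om : symplectic_form E) :
  isotropic Om M -> isotropic Om (push_sub N).
Proof.
move=> M_iso x u /push_subP[v Nv ->] w /push_subP[z Nz ->].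
exact: (M_iso x _ (subvsP v) _ (subvsP z)).
Qed.

Section RestrictEnd.
Variable f : forall x, 'End(fib E x).

Definition res_end x : 'End(fib (sub_bundle M) x) :=
  (linfun (vsproj (M x)) \o (f x \o linfun (@vsval _ _ (M x))))%VF.

Hypothesis f_mem : forall x u, u \in M x -> f x u \in M x.

Lemma res_endE x u : vsval (res_end x u) = f x (vsval u).
Proof.
rewrite !comp_lfunE !lfunE /= vsprojK //; apply: f_mem; exact: subvsP.
Qed.

Lemma hol_res_end x : hol_hom (fun y => f y) x -> hol_hom (fun y => res_end y) x.
Proof.
move=> hf s hs; apply: hol_vec_sub.
rewrite (_ : (fun _ => _) = fun y => f y (vsval (s y))).
  exact: hf (hol_vec_val hs).
by apply: functional_extensionality_dep => y; rewrite res_endE.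
Qed.
End RestrictEnd.

End SubSub.

Section Stability.
Local Open Scope classical_set_scope.
Local Open Scope ring_scope.
Variables (R : realType) (X : riemann_surface R).
Let C := cplx R.

Definition degree0_isotropic n (H : ustar_higgs X n) (N : subbundle (us_bundle H)) :=
  [/\ isotropic (us_form H) N, hf_invariant (us_field H) N,
      (0 < sub_rk N < rk (us_bundle H))%N & deg (sub_bundle N) = 0].

(** The form of polystability that is inherited by the orthogonal of
    [N (+) N^*]. *)
Definition splitting_property n (H : ustar_higgs X n) := us_semistable H /\
  forall N, degree0_isotropic N ->
    exists p p', isotropic_splitting (us_form H) (us_field H) N p p'.

Lemma polystable_splitting n (H : ustar_higgs X n) :
  us_polystable H -> splitting_property H.
Proof.
case=> ss compl _; split => // N [N_iso N_inv N_rk N_deg].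
have [W' [coW' W'_inv _ NW']] := compl N N_iso N_inv N_rk N_deg.
exact: complement_splitting NW' _ _ N_inv W'_inv coW'.
Qed.

Lemma unstable_degree0 n (H : ustar_higgs X n) :
  us_semistable H -> ~ us_stable H -> exists N, degree0_isotropic (H := H) N.
Proof.
move=> ss; apply: contra_notP => nN; split => // N N_iso N_inv N_rk.
rewrite lt_neqAle (ss N) // andbT; apply/eqP => N_deg.
by apply: nN; exists N.
Qed.

Lemma minimal_degree0 n (H : ustar_higgs X n) :
  (exists N, degree0_isotropic (H := H) N) ->
  exists N, degree0_isotropic (H := H) N /\
    forall N', degree0_isotropic (H := H) N' -> (sub_rk N <= sub_rk N')%N.
Proof.
move=> [N0 N0P].
pose P m := `[< exists N, degree0_isotropic (H := H) N /\ sub_rk N = m >].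
have exP : exists m, P m by exists (sub_rk N0); apply/asboolP; exists N0.
have [m /asboolP[N [NP Nm]] m_min] := ex_minnP exP.
exists N; split => // N' N'P; rewrite Nm; apply: m_min.
by apply/asboolP; exists N'.
Qed.

Section SplitOff.
Variables (n : nat) (H : ustar_higgs X n).
Local Notation E := (us_bundle H).
Local Notation om := (sform (us_form H)).
Local Notation phi := (us_field H).
Variables (N : subbundle E) (p p' : forall x, 'End(fib E x)).
Hypothesis N_iso : isotropic (us_form H) N.

(** The slope of [N] is 0, and an invariant subbundle of [N] is isotropic and
    invariant in the whole bundle: its degree is at most 0, and it is not 0 by
    minimality of the rank of [N]. *)
Lemma sub_higgs_stable (N_inv : hf_invariant phi N) :
  us_semistable H -> degree0_isotropic N ->
  (forall N', degree0_isotropic (H := H) N' -> (sub_rk N <= sub_rk N')%N) ->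
  gl_stable (sub_higgs N_inv).
Proof.
move=> ss [_ _ /andP[N_gt0 N_lt] N_deg] N_min W /andP[W_gt0 W_lt] W_inv.
pose V := push_sub W.
have V_iso : isotropic (us_form H) V by exact: push_sub_isotropic_sub.
have V_inv : hf_invariant phi V by exact: push_sub_inv W_inv.
rewrite /slope /= N_deg mul0r -deg_push_sub -/V.
rewrite pmulr_llt0 ?invr_gt0 ?ltr0n // ltrz0.
rewrite lt_neqAle ss // andbT; apply/eqP => V_deg.
have : (sub_rk N <= sub_rk V)%N.
  apply: N_min; split => //; rewrite W_gt0 /=.
  exact: ltn_trans W_lt N_lt.
by rewrite leqNgt W_lt.
Qed.

Hypothesis Np : isotropic_splitting (us_form H) phi N p p'.

(** Let [V] be isotropic of degree 0 in [M = im q], and [r] a projector onto [V]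
    in the whole bundle, with adjoint [r'] and [r r' = 0]. In [M] the compression
    [r q] is a projector onto [V] with adjoint [q r'], but [b = r q r'] need not
    vanish. Since [b] is self-adjoint with image in [V] and [r' r = 0], the
    projector [s = r q - b / 2] has adjoint [s' = q r' - b / 2] and
    [s s' = b - b / 2 - b / 2 = 0]. *)
Lemma orth_splitting :
  splitting_property H -> splitting_property (orth_higgs N_iso Np).
Proof.
set M := orth N_iso Np; case=> ss spl; split.
  move=> W W_iso W_inv; rewrite -deg_push_sub; apply: ss.
    exact: push_sub_isotropic W_iso.
  exact: push_sub_inv W_inv.
move=> W [W_iso W_inv W_rk W_deg]; pose V := push_sub W.
have V_iso : isotropic (us_form H) V by exact: push_sub_isotropic W_iso.
have V_inv : hf_invariant phi V by exact: push_sub_inv W_inv.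
have VM x u : u \in V x -> u \in M x by move=> /push_subP[v _ ->]; exact: subvsP.
have [|r [r' Vr]] := spl V.
  split => //; last by rewrite deg_push_sub.
  case/andP: W_rk => -> /= W_lt; apply: leq_trans W_lt _.
  have [x _] := rs_nonempty X.
  change (sub_rk M <= rk E)%N.
  by rewrite -(dim_fib E x) -(dim_sub_fib M x) dimvS ?subvf.
pose q := coproj p p'.
have qM x u : u \in M x -> q x u = u by rewrite mem_orth => /eqP.
have Mq x u : q x u \in M x by exact: coproj_mem.
have qr x u : q x (r x u) = r x u by apply/qM/VM; exact: (split_mem Vr).
have r'q x u : r' x (q x u) = r' x u.
  apply: (sform_inj (Om := us_form H)) => w.
  by rewrite -!(split_adj Vr) -(coproj_adj Np) qr.
pose b x := (r x \o (q x \o r' x))%VF.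
have bE x u : b x u = r x (q x (r' x u)) by rewrite !comp_lfunE.
have b_adj x u v : om (b x u) v = om u (b x v).
  rewrite !bE (split_adj Vr) (coproj_adj Np) (split_adj' Vr) //.
pose s x := ((r x \o q x) - 2^-1 *: b x)%VF.
pose s' x := ((q x \o r' x) - 2^-1 *: b x)%VF.
have sE x u : s x u = r x (q x u) - 2^-1 *: b x u.
  by rewrite add_lfunE opp_lfunE scale_lfunE comp_lfunE.
have s'E x u : s' x u = q x (r' x u) - 2^-1 *: b x u.
  by rewrite add_lfunE opp_lfunE scale_lfunE comp_lfunE.
have hol_q x : hol_hom (fun y => q y) x by exact: hol_coproj Np x.
have hol_b x : hol_hom (fun y => b y) x.
  move=> t ht; rewrite (_ : (fun _ => _) = fun y => r y (q y (r' y (t y)))).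
    exact: (split_hol Vr (hol_q x _ (split_hol' Vr ht))).
  by apply: functional_extensionality_dep => y; rewrite bE.
have hol_s x : hol_hom (fun y => s y) x.
  move=> t ht; rewrite (_ : (fun _ => _) = fun y =>
      r y (q y (t y)) - 2^-1 *: b y (t y)).
    apply: hol_vecB; first exact: (split_hol Vr (hol_q x _ ht)).
    exact: (hol_vecZ (@holo_at_cst R X x _) (hol_b x _ ht)).
  by apply: functional_extensionality_dep => y; rewrite sE.
have hol_s' x : hol_hom (fun y => s' y) x.
  move=> t ht; rewrite (_ : (fun _ => _) = fun y =>
      q y (r' y (t y)) - 2^-1 *: b y (t y)).
    apply: hol_vecB; first exact: (hol_q x _ (split_hol' Vr ht)).
    exact: (hol_vecZ (@holo_at_cst R X x _) (hol_b x _ ht)).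
  by apply: functional_extensionality_dep => y; rewrite s'E.
have b_mem x u : b x u \in V x by rewrite bE; exact: (split_mem Vr).
have s_mem x u : s x u \in V x.
  by rewrite sE; apply: memvB; [exact: (split_mem Vr)|exact/memvZ/b_mem].
have s'_mem x u : s' x u \in M x.
  by rewrite s'E; apply: memvB; [exact: Mq|exact/memvZ/VM/b_mem].
have sM x u : u \in M x -> s x u \in M x by move=> _; exact: VM (s_mem x u).
have s'M x u : u \in M x -> s' x u \in M x by move=> _; exact: s'_mem.
exists (res_end M s), (res_end M s'); split.
- by move=> x; apply: hol_res_end.
- by move=> x; apply: hol_res_end.
- move=> x u v; rewrite /= /res_form_fun !res_endE // sE s'E.
  by rewrite sformBl sformBr sformZl sformZr b_adj (split_adj Vr) (coproj_adj Np).
- move=> i x u ix; apply: val_inj.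
  have M_inv : hf_invariant phi M by exact: orth_inv.
  change (vsval (res_hf M phi i x (res_end M s x u)) =
    vsval (res_end M s x (res_hf M phi i x u))).
  rewrite (res_hfE M_inv (res_end M s x u) ix) (res_endE sM u).
  rewrite (res_endE sM (res_hf M phi i x u)) (res_hfE M_inv u ix).
  rewrite !sE !bE linearB linearZ /= !(split_comm Vr) // !(coproj_comm Np) //.
  by rewrite (split_comm' Vr).
- by move=> x u; rewrite -mem_push_sub (res_endE sM); exact: s_mem.
- move=> x u Wu; apply: val_inj; rewrite /= (res_endE sM) sE bE.
  have Vu : vsval u \in V x by rewrite mem_push_sub.
  have r'u : r' x (vsval u) = 0.
    by rewrite -(split_id Vr Vu) (split_isotropic V_iso Vr).
  rewrite (qM _ _ (subvsP u)) (split_id Vr Vu) r'u !linear0.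
  by rewrite addr0.
- move=> x u; apply: val_inj; rewrite /= (res_endE sM) (res_endE s'M).
  move: (vsval u) => w.
  have sb : s x (b x w) = b x w.
    rewrite sE (qM _ _ (VM _ _ (b_mem x w))) (split_id Vr (b_mem x w)).
    by rewrite (bE _ (b x w)) bE (split_isotropic V_iso Vr) !linear0 addr0.
  have sq : s x (q x (r' x w)) = 2^-1 *: b x w.
    rewrite sE (qM _ _ (Mq x _)) (bE _ (q x _)) r'q (split_idem' Vr) -bE.
    by rewrite -[X in X - _]scale1r -scalerBl; congr (_ *: _); field.
  by rewrite s'E linearB linearZ /= sb sq subrr.
Qed.

End SplitOff.
End Stability.

(** * Isomorphisms and the decomposition *)

Section Isomorphisms.
Local Open Scope classical_set_scope.
Local Open Scope ring_scope.
Variables (R : realType) (X : riemann_surface R).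
Let C := cplx R.

(** The same notion with holomorphy tested on sections, which makes
    composition immediate. *)
Lemma us_isoP n m (H : ustar_higgs X n) (H' : ustar_higgs X m) :
  us_iso H H' <->
  exists f : forall x, 'Hom(fib (us_bundle H) x, fib (us_bundle H') x),
  [/\ forall x, bijective (f x), forall x, hol_hom (fun y => f y) x,
      forall x u v, sform (us_form H') (f x u) (f x v) = sform (us_form H) u v
    & forall i x u, cdom i x ->
        f x (us_field H i x u) = us_field H' i x (f x u)].
Proof.
split=> -[f [fbij fhol fform ffield]]; exists f; split => //.
  move=> x; apply/(hol_homP f x) => a b k l ax bx.
  exact: fhol (conj ax bx).
move=> a b k l x [ax bx].
exact: ((hol_homP f x).2 (fhol x) a b k l ax bx).
Qed.

Lemma us_iso_trans n m l (H : ustar_higgs X n) (H' : ustar_higgs X m)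
    (H'' : ustar_higgs X l) : us_iso H H' -> us_iso H' H'' -> us_iso H H''.
Proof.
move=> /us_isoP[f [fbij fhol fform ffield]] /us_isoP[g [gbij ghol gform gfield]].
apply/us_isoP; exists (fun x => (g x \o f x)%VF).
have gfE x u : (g x \o f x)%VF u = g x (f x u) by rewrite comp_lfunE.
split.
- move=> x; apply: eq_bij (bij_comp (gbij x) (fbij x)) _ _ => u.
  by rewrite /= gfE.
- move=> x s hs; rewrite (_ : (fun _ => _) = fun y => g y (f y (s y))).
    exact: ghol (fhol x _ hs).
  by apply: functional_extensionality_dep => y; rewrite gfE.
- by move=> x u v; rewrite !gfE gform fform.
- by move=> i x u ix; rewrite !gfE ffield // gfield.
Qed.

Lemma us_iso_sumr n m l (K : ustar_higgs X l) (H : ustar_higgs X n)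
    (H' : ustar_higgs X m) :
  us_iso H H' -> us_iso (us_sum K H) (us_sum K H').
Proof.
move=> /us_isoP[f [fbij fhol fform ffield]]; apply/us_isoP.
pose h x : 'Hom(fib (us_bundle (us_sum K H)) x, fib (us_bundle (us_sum K H')) x) :=
  lpair (linfun fst) (f x \o linfun snd)%VF.
have hE x w : h x w = (w.1, f x w.2) by rewrite lpairE comp_lfunE !lfunE.
exists h; split.
- move=> x; have [g fK gK] := fbij x; exists (fun w => (w.1, g w.2)) => -[u v].
    by rewrite hE /= fK.
  by rewrite hE /= gK.
- move=> x s hs; rewrite (_ : (fun _ => _) = fun y => ((s y).1, f y (s y).2)).
    exact: hol_vec_pair (hol_vec_fst hs) (fhol x _ (hol_vec_snd hs)).
  by apply: functional_extensionality_dep => y; rewrite hE.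
- by move=> x u v; rewrite !hE /= /sum_form_fun /= fform.
- by move=> i x u ix; rewrite !hE /= /sum_hf !pair_lfunE /= ffield.
Qed.

Lemma us_iso_sum0 n (H : ustar_higgs X n) : us_iso H (us_sum H (us_zero X)).
Proof.
apply/us_isoP.
pose h x : 'Hom(fib (us_bundle H) x, fib (us_bundle (us_sum H (us_zero X))) x) :=
  lpair \1%VF 0%VF.
have hE x w : h x w = (w, 0) by rewrite lpairE id_lfunE zero_lfunE.
exists h; split.
- move=> x; exists fst => [u|[u v]]; rewrite hE //.
  by congr pair; rewrite [v]thinmx0.
- move=> x s hs; rewrite (_ : (fun _ => _) = fun y => (s y, 0)).
    exact: (@hol_vec_pair _ _ _ (zero_bundle X) _ _ _ hs (@hol_vec0 _ _ _ x)).
  by apply: functional_extensionality_dep => y; rewrite hE.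
- by move=> x u v; rewrite !hE /= /sum_form_fun /= addr0.
- by move=> i x u ix; rewrite !hE /= /sum_hf !pair_lfunE /= linear0.
Qed.

Lemma us_iso_rank0 (H : ustar_higgs X 0) : us_iso H (us_zero X).
Proof.
apply/us_isoP; have u0 x (u : fib (us_bundle H) x) : u = 0.
  apply/eqP; rewrite -memv0; have := memvf u.
  suff -> : fullv = 0%VS :> {vspace fib (us_bundle H) x} by [].
  by apply/eqP; rewrite -dimv_eq0 dim_fib sp_rk.
exists (fun x => 0%VF); split.
- move=> x; exists (fun=> 0) => u; first by rewrite [LHS]u0 [RHS]u0.
  by rewrite zero_lfunE [RHS]thinmx0.
- move=> x s hs; rewrite (_ : (fun _ => _) = fun y => 0).
    exact: (@hol_vec0 _ _ (zero_bundle X) x).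
  by apply: functional_extensionality_dep => y; rewrite zero_lfunE.
- by move=> x u v; rewrite [u]u0 sform0l.
- by move=> i x u ix; rewrite !zero_lfunE.
Qed.

(** By induction on [n]: a stable bundle is its own decomposition, and otherwise
    the pair [N (+) N^*] of a smallest obstruction [N] to stability is split off. *)
Lemma splitting_decomposition n (H : ustar_higgs X n) :
  splitting_property H ->
  exists s : seq {m : nat & ustar_higgs X m},
    List.Forall (fun G => (0 < tag G <= n)%N /\ stable_summand (tagged G)) s /\
    us_iso H (us_bigsum s).
Proof.
have [k] := ubnP n; elim: k n H => // k IH n H.
rewrite ltnS => n_le_k H_split.
case: (posnP n) => [n0|n_gt0].
  by subst n; exists [::]; split; [exact: List.Forall_nil|exact: us_iso_rank0].
have [H_stable|H_unstable] := pselect (us_stable H).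
  exists [:: existT _ n H]; split; last exact: us_iso_sum0.
  apply: List.Forall_cons; last exact: List.Forall_nil.
  by rewrite /= n_gt0 leqnn; split => //; exact: SummandUstar.
have [N [N0 N_min]] := minimal_degree0 (unstable_degree0 H_split.1 H_unstable).
have [p [p' Np]] := H_split.2 N N0.
have [N_iso N_inv /andP[N_gt0 _] _] := N0.
have N_le := split_rk N_iso Np.
have [|s [s_stable s_iso]] := IH _ (orth_higgs N_iso Np) _ (orth_splitting N_iso Np H_split).
  by apply: leq_trans n_le_k; rewrite -subn_gt0 subKn.
exists (existT _ (sub_rk N) (us_of_gl (sub_higgs N_inv)) :: s); split; last first.
  exact: us_iso_trans (us_iso_split N_iso N_inv Np) (us_iso_sumr _ s_iso).
apply: List.Forall_cons.
  rewrite /= N_gt0 N_le; split => //; apply: SummandGL.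
  refine (sub_higgs_stable N_iso H_split.1 N0 N_min).
apply: List.Forall_impl s_stable => G [/andP[-> G_le] ?]; split => //.
exact: leq_trans G_le (leq_subr _ _).
Qed.

End Isomorphisms.

Theorem theorem3p19 (R : realType) (X : riemann_surface R) (g n : nat)
    (H : ustar_higgs X n)
    (X_compact : compact [set: X]%classic)
    (X_genus : has_genus X g) (g_ge2 : (2 <= g)%N)
    (H_polystable : us_polystable H) :
  exists s : seq {m : nat & ustar_higgs X m},
    List.Forall (fun G => (0 < tag G <= n)%N /\ stable_summand (tagged G)) s /\
    us_iso H (us_bigsum s).
Proof. exact: splitting_decomposition (polystable_splitting H_polystable). Qed.
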